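(* Let $P$ be a probability measure on $\mathcal S^{\downarrow}$ with $E_P(\mathcal H)<\infty$, and let $\kappa>0$. Then $$\lim_{n\to\infty}E_{\mathbf P(\cdot\mid\pi^n)}(\mathfrak G^{(\kappa)})=\mathfrak G^{(\kappa)}(S)=\lim_{n\to\infty}\mathfrak G^{(\kappa)}(\pi^n/n)\quad \mathbb P\text{-a.s. and in }L^p(\mathbb P)\ \text{ for all } p\ge1,$$ and $$\lim_{n\to\infty}E_{\mathbf P(\cdot\mid\pi^n)}(\mathcal H)=\mathcal H(S)=\lim_{n\to\infty}\mathcal H(\pi^n/n)\quad \mathbb P\text{-a.s.},$$ where the left limit in the last relation (that of $E_{\mathbf P(\cdot\mid\pi^n)}(\mathcal H)$ to $\mathcal H(S)$) also holds in $L^1(\mathbb P)$.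
   Context: $\mathbb N=\{1,2,\dots\}$. $\mathcal S^{\downarrow}=\{s=(s(i):i\in\mathbb N): s(i)\ge s(i+1)\ge 0\ \forall i,\ \sum_{i}s(i)=1\}$, with probability measure $P$, expectation $E_P$, and $S\sim P$. For a nonnegative sequence $s$ with $\sum_i s(i)=1$ (finite vectors are padded with zeros, and order is irrelevant): the Shannon entropy is $\mathcal H(s)=-\sum_{i}s(i)\log s(i)$ with $0\log 0=0$, and the generalized Gini function of parameter $\kappa>0$ is $\mathfrak G^{(\kappa)}(s)=1-\sum_i s(i)^{\kappa+1}$. To $s\in\mathcal S^{\downarrow}$ one associates disjoint open subintervals of $[0,1]$ whose lengths ranked decreasingly are $s$. Let $(X_l:l\ge1)$ be i.i.d. uniform on $[0,1]$, independent of $S$; $\mathbb P$ is the joint law of $S$ and $(X_l)$. Two individuals $X_l,X_m$ are of the same species if they fall in the same interval associated with $S$; species are numbered $1,2,\dots$ in order of first appearance. $k^n$ is the number of species among $X_1,\dots,X_n$, $\pi^n(j)$ is the number of the first $n$ individuals in the $j$-th discovered species, and $\pi^n=(\pi^n(1),\dots,\pi^n(k^n))$. $\mathbf P$ is the joint law of $S$ and $(\pi^n:n\in\mathbb N)$, and $E_{\mathbf P(\cdot\mid\pi^n)}(G)$ is the Bayes posterior mean, i.e. the conditional expectation of $G(S)$ given $\pi^n$. The plug-in estimator of $G$ at step $n$ is $G(\pi^n/n)$. *)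

(* Defs.v *)
From HB Require Import structures.
From mathcomp Require Import all_boot all_order all_algebra.
From mathcomp Require Import all_classical all_reals all_analysis.
From mathcomp Require Import measurable_realfun.

Set Implicit Arguments.
Unset Strict Implicit.
Unset Printing Implicit Defensive.

Import Order.TTheory GRing.Theory Num.Theory.
Import numFieldNormedType.Exports.

Local Open Scope classical_set_scope.
Local Open Scope ring_scope.

Record massPartition (R : realType) := MassPartition {
  mass :> nat -> R;
  mass_nonincr : forall i, mass i.+1 <= mass i;
  mass_ge0 : forall i, 0 <= mass i;
  mass_sum1 : (\sum_(0 <= i <oo) (mass i)%:E = 1)%E }.

Section mass_partition_measurable.
Variable R : realType.

Let dirac_mass (i : nat) : R := (i == 0)%:R.

Let dirac_mass_nonincr i : dirac_mass i.+1 <= dirac_mass i.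
Proof. by rewrite /dirac_mass ler0n. Qed.

Let dirac_mass_ge0 i : 0 <= dirac_mass i.
Proof. by rewrite /dirac_mass ler0n. Qed.

Let dirac_mass_sum1 : (\sum_(0 <= i <oo) (dirac_mass i)%:E = 1)%E.
Proof.
rewrite (@nneseries_split _ _ 0%N 1%N); last by move=> k _; rewrite lee_fin.
by rewrite add0n big_nat1 eseries0 ?adde0// => -[].
Qed.

HB.instance Definition _ := gen_eqMixin (massPartition R).
HB.instance Definition _ := gen_choiceMixin (massPartition R).
HB.instance Definition _ := isPointed.Build (massPartition R)
  (MassPartition dirac_mass_nonincr dirac_mass_ge0 dirac_mass_sum1).

(* The sigma-algebra on mass partitions is the one generated by the
   coordinate maps (the trace of the product sigma-algebra of R^N). *)
Definition mass_cylinders : set (set (massPartition R)) :=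
  [set A | exists (i : nat) (B : set R),
     measurable B /\ A = [set s : massPartition R | B (s i)]].

HB.instance Definition _ :=
  @isMeasurable.Build (sigma_display mass_cylinders) (massPartition R)
    <<s mass_cylinders >>
    (@sigma_algebra0 _ setT mass_cylinders)
    (@sigma_algebraC _ mass_cylinders)
    (@sigma_algebra_bigcup _ setT mass_cylinders).

End mass_partition_measurable.

Section diversity.
Variable R : realType.
Local Open Scope ereal_scope.

(* Both functionals are \bar R-valued, as the entropy may be +oo. *)
Definition shannon (s : nat -> R) : \bar R :=
  - \sum_(0 <= i <oo) (s i * ln (s i))%:E.

Definition gini (kappa : R) (s : nat -> R) : \bar R :=
  1 - \sum_(0 <= i <oo) (s i `^ (kappa + 1))%:E.

(* pi / n, padded with zeros. *)
Definition frequencies (n : nat) (pi : seq nat) : nat -> R :=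
  fun j => ((nth 0%N pi j)%:R / n%:R)%R.

End diversity.

Section species.
Variable R : realType.

(* The interval associated with the i-th mass s i is ]a s i, a s i + s i[,
   which is empty when s i = 0. *)
Definition species_interval (a : massPartition R -> nat -> R)
    (s : massPartition R) (i : nat) : set R :=
  `]a s i, a s i + s i[%classic.

(* Any choice of intervals is allowed, as long as their left endpoints depend
   measurably on s, so that the partitions pi^n below are random variables. *)
Record interval_arrangement (a : massPartition R -> nat -> R) : Prop := {
  arrangement_measurable : forall i,
    measurable_fun [set: massPartition R] (fun s => a s i);
  arrangement_sub01 : forall s i,
    species_interval a s i `<=` `[0, 1]%classic;
  arrangement_disjoint : forall s, trivIset setT (species_interval a s) }.

Variables (a : massPartition R -> nat -> R) (s : massPartition R).
(* x l is the position of individual l; individuals are numbered from 0. *)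
Variable x : nat -> R.

(* An individual lying in no interval (a null event) forms a species of its
   own. *)
Definition same_species : rel nat := fun l m =>
  (l == m) || `[< exists i, species_interval a s i (x l) /\
                            species_interval a s i (x m) >].

Definition new_species (l : nat) : bool :=
  ~~ has (same_species l) (iota 0 l).

(* The first individuals of the species discovered among the first n
   individuals, in order of appearance; the j-th discovered species is
   identified with the j-th entry. *)
Definition discoverers (n : nat) : seq nat :=
  [seq l <- iota 0 n | new_species l].

Definition species_number (n : nat) : nat := size (discoverers n).

Definition species_counts (n : nat) : seq nat :=
  [seq count (same_species l) (iota 0 n) | l <- discoverers n].

Lemma size_species_counts n : size (species_counts n) = species_number n.
Proof. by rewrite size_map. Qed.

End species.

Section probability_notions.
Context d (T : measurableType d) (R : realType).
Variable PP : probability T R.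
Local Open Scope ereal_scope.

(* Mutual independence of the family S, X 0, X 1, ... Taking B l = setT for
   some l yields the product rule for every finite subfamily. *)
Definition mutually_independent d1 (T1 : measurableType d1)
    (S : {RV PP >-> T1}) (X : nat -> {RV PP >-> R}) : Prop :=
  forall (A : set T1) (B : nat -> set R) (n : nat),
    measurable A -> (forall l, measurable (B l)) ->
    PP (S @^-1` A `&` \bigcap_(l < n) (X l @^-1` B l)) =
    PP (S @^-1` A) * \prod_(l < n) PP (X l @^-1` B l).

(* Every subset of seq nat is measurable, seq nat being countable. *)
Definition sigma_of (V : T -> seq nat) : set (set T) :=
  [set V @^-1` C | C in [set: set (seq nat)]].

(* Y is a version of the conditional expectation of f given V. *)
Definition is_cond_expectation (V : T -> seq nat) (f Y : T -> \bar R) : Prop :=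
  [/\ forall B : set (\bar R), measurable B -> sigma_of V (Y @^-1` B),
      PP.-integrable setT Y
    & forall A, sigma_of V A -> \int[PP]_(w in A) Y w = \int[PP]_(w in A) f w].

Definition cvg_as (Y : nat -> T -> \bar R) (Z : T -> \bar R) : Prop :=
  {ae PP, forall w, Y n w @[n --> \oo] --> Z w}.

Definition in_Lp (p : R) (f : T -> \bar R) : Prop :=
  measurable_fun setT f /\ 'N[PP]_p%:E[f] < +oo.

Definition cvg_Lp (p : R) (Y : nat -> T -> \bar R) (Z : T -> \bar R) : Prop :=
  [/\ forall n, in_Lp p (Y n), in_Lp p Z
    & 'N[PP]_p%:E[(fun w => Y n w - Z w)] @[n --> \oo] --> 0].

End probability_notions.

(* Main.v *)
Require Import Defs.
From HB Require Import structures.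
From mathcomp Require Import all_boot all_order all_algebra.
From mathcomp Require Import all_classical all_reals all_analysis.
From mathcomp Require Import measurable_realfun.
From mathcomp Require Import ring lra.

(** Almost surely, for every i at once, the frequency among the first n
    individuals of the species attached to the i-th interval tends to its
    length S(i) [ae_species_frequency].  This is the Glivenko-Cantelli theorem:
    the convergence of the empirical distribution function at rational points
    gives the convergence of the frequency of every subinterval of [0, 1] outside
    one null set, so that it may be used for the random intervals attached to S
    without conditioning on S.  Both plug-in estimators are sums over species of
    a function of the frequencies.  For the Gini function each summand is at most
    the frequency itself; the frequencies have total 1, as have their limits, so
    no mass escapes to species of large index and the sums converge
    [cvg_plugin_gini].  For the entropy [cvg_plugin_shannon], the summands being
    nonnegative, the lower bound follows from finitely many of them.  For the
    upper bound, Gibbs' inequality compares the empirical entropy with the mean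
    over individuals of - ln S(species of the individual).  The part of that mean
    due to species of index at least M is small uniformly in n, because its
    supremum over n is controlled by its expectation, which is a tail of the
    series defining the finite mean entropy [ae_mean_surprise].

    The posterior means would be a closed martingale if the counts pi^n generated
    a filtration, but pi^(n+1) does not determine pi^n.  The partition of the
    first n individuals into species does determine the earlier ones, and given
    the counts it carries no information on S: individuals are exchangeable, and
    two partitions with the same counts differ by a permutation of the
    individuals [integral_history_exchangeable].  Hence conditioning on the
    counts amounts to conditioning on the whole history
    [cond_expectation_history], and Levy's upward theorem applies to G(S), which
    is the almost sure limit of functions of the finite histories, namely of the
    plug-in estimators [levy_ae, levy_L1, approximable_of_ae_cvg].

    A single maximal inequality serves all three limits [maximal_gt].  Run
    forwards along the histories it gives Levy's theorem.  Run backwards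
    [maximal_gt_reverse] along the events that are symmetric in the first n
    individuals, given which a sample mean is the conditional expectation of one
    observation, it gives the law of large numbers and the uniform control of the
    tail of the empirical entropy [maximal_sample_mean_gt].  *)

Set Implicit Arguments.
Unset Strict Implicit.
Unset Printing Implicit Defensive.

Import Order.TTheory GRing.Theory Num.Theory.
Import numFieldNormedType.Exports.

Local Open Scope classical_set_scope.
Local Open Scope ring_scope.

(** * A maximal inequality *)

Section maximal.
Context d (T : measurableType d) (R : realType) (mu : probability T R).
Local Open Scope ereal_scope.

Lemma measurable_set_gt (f : T -> R) (lam : R) : measurable_fun setT f ->
  measurable [set w | (lam < f w)%R].
Proof.
move=> mf; rewrite [X in measurable X](_ : _ = f @^-1` `]lam, +oo[%classic).
  by rewrite -[X in measurable X]setTI; apply: mf.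
by apply/seteqP; split=> w /=; rewrite in_itv/= andbT.
Qed.

(** Rings of events suffice: the maximal inequality combines only finitely
    many events at a time. *)
Record subalgebra (F : set (set T)) : Prop := {
  subalgebra_measurable : forall A, F A -> measurable A;
  subalgebraU : forall A B, F A -> F B -> F (A `|` B);
  subalgebraD : forall A B, F A -> F B -> F (A `\` B) }.

(** Split the union according to the first index n with lam < Vn n.  The n-th
    piece belongs to F n, so lam times its measure is at most the integral over it
    of Vn n, which is that of V. *)
Lemma maximal_gt (F : nat -> set (set T)) (V : T -> R) (Vn : nat -> T -> R)
    (lam : R) : (0 <= lam)%R ->
  (forall n, subalgebra (F n)) -> {homo F : n m / (n <= m)%N >-> n `<=` m} ->
  mu.-integrable setT (EFin \o V) ->
  (forall n, mu.-integrable setT (EFin \o Vn n)) ->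
  (forall n, F n [set w | (lam < Vn n w)%R]) ->
  (forall n A, F n A -> \int[mu]_(w in A) (Vn n w)%:E = \int[mu]_(w in A) (V w)%:E) ->
  lam%:E * mu (\bigcup_n [set w | (lam < Vn n w)%R]) <= \int[mu]_w `|(V w)%:E|.
Proof.
move=> lam0 sF ndF iV iVn gtF condV.
pose B n := [set w | (lam < Vn n w)%R].
have mB n : measurable (B n) by exact: (subalgebra_measurable (sF n)).
have FC n : F n (seqDU B n).
  rewrite /seqDU; apply: subalgebraD => //.
  (* events of earlier indices belong to F n because F increases *)
  have F0 : F n set0 by rewrite -(setDv (B n)); exact: subalgebraD.
  apply: big_ind => //; first exact: subalgebraU.
  by move=> i _; apply: (ndF i n (ltnW (ltn_ord i))).
have mC n : measurable (seqDU B n) by exact: (subalgebra_measurable (sF n)).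
rewrite -/(\bigcup_n B n) seqDU_bigcup_eq measure_bigcup//=.
rewrite (eq_eseriesl (Q := xpredT)); last by move=> i; rewrite in_setT.
rewrite -nneseriesZl//.
apply: (@le_trans _ _ (\sum_(0 <= i <oo) \int[mu]_(w in seqDU B i) `|(V w)%:E|)).
  apply: lee_nneseries => [n _ _|n _].
  - by rewrite mule_ge0// lee_fin.
  - have iVC : mu.-integrable (seqDU B n) (EFin \o V) by exact: integrableS iV.
    have iVnC : mu.-integrable (seqDU B n) (EFin \o Vn n).
      by exact: integrableS (iVn n).
    rewrite -integral_cst//.
    apply: (@le_trans _ _ (\int[mu]_(w in seqDU B n) (Vn n w)%:E)).
      apply: le_integral => //.
        exact: finite_measure_integrable_cst.
      move=> w /set_mem [Bw _]; rewrite lee_fin; exact: ltW.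
    rewrite condV//; apply: le_integral => //; first exact: integrable_abse.
    by move=> w _; rewrite lee_fin ler_norm.
rewrite -ge0_integral_bigcup//; last first.
  apply: (measurable_funS measurableT) => //.
  by apply: measurableT_comp => //; case/integrableP: iV.
apply: ge0_subset_integral => //; first exact: bigcupT_measurable.
by apply: measurableT_comp => //; case/integrableP: iV.
Qed.

(** Reading the indices N, ..., 0 in that order makes the family increasing; then
    N tends to infinity.  The truncated subtraction N - k only repeats the index 0. *)
Lemma maximal_gt_reverse (F : nat -> set (set T)) (V : T -> R) (Vn : nat -> T -> R)
    (lam : R) : (0 <= lam)%R ->
  (forall n, subalgebra (F n)) -> {homo F : n m / (m <= n)%N >-> n `<=` m} ->
  mu.-integrable setT (EFin \o V) ->
  (forall n, mu.-integrable setT (EFin \o Vn n)) ->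
  (forall n, F n [set w | (lam < Vn n w)%R]) ->
  (forall n A, F n A -> \int[mu]_(w in A) (Vn n w)%:E = \int[mu]_(w in A) (V w)%:E) ->
  lam%:E * mu (\bigcup_n [set w | (lam < Vn n w)%R]) <= \int[mu]_w `|(V w)%:E|.
Proof.
move=> lam0 sF niF iV iVn gtF condV.
pose B n := [set w | (lam < Vn n w)%R].
have mB n : measurable (B n) by exact: (subalgebra_measurable (sF n)).
pose G N := \bigcup_k B (N - k)%N.
have mG N : measurable (G N) by exact: bigcupT_measurable.
have GE : \bigcup_n B n = \bigcup_N G N.
  apply/seteqP; split => [w [n _ Bn]|w [N _ [k _ Bk]]]; last by exists (N - k)%N.
  by exists n => //; exists 0%N; rewrite ?subn0.
have leG N : lam%:E * mu (G N) <= \int[mu]_w `|(V w)%:E|.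
  apply: (@maximal_gt (fun k => F (N - k)%N) V (fun k => Vn (N - k)%N)) => //.
  - by move=> n m nm; apply: niF; rewrite leq_sub2l.
  - by move=> n A; exact: condV.
rewrite (_ : \bigcup_n _ = \bigcup_N G N); last exact: GE.
have cG : lam%:E * mu (G N) @[N --> \oo] --> lam%:E * mu (\bigcup_N G N).
  apply: cvgeZl => //; apply: nondecreasing_cvg_mu => //.
    exact: bigcupT_measurable.
  move=> n m nm; apply/subsetPset => w [k _ Bk].
  exists (m - (n - k))%N => //; rewrite subKn//.
  by rewrite (leq_trans (leq_subr _ _)).
rewrite -(cvg_lim _ cG)//; apply: lime_le; first by apply/cvg_ex; eexists; exact: cG.
exact: nearW.
Qed.

Lemma measure_bigcup_gt_normr (Vn : nat -> T -> R) (lam : R) :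
  (forall n, measurable_fun setT (Vn n)) ->
  mu (\bigcup_n [set w | (lam < `|Vn n w|)%R]) <=
  mu (\bigcup_n [set w | (lam < Vn n w)%R]) +
  mu (\bigcup_n [set w | (lam < - Vn n w)%R]).
Proof.
move=> mVn.
have mgt (f : nat -> T -> R) : (forall n, measurable_fun setT (f n)) ->
    measurable (\bigcup_n [set w | (lam < f n w)%R]).
  by move=> mf; apply: bigcupT_measurable => n; exact: measurable_set_gt.
have mN n : measurable_fun setT (fun w => - Vn n w)%R by exact: measurableT_comp.
apply: le_trans (measureU2 _ _ _) => //; [|exact: mgt|exact: mgt].
apply: le_measure; rewrite ?inE; [|apply: measurableU; exact: mgt|].
  by apply: mgt => n; exact: measurableT_comp.
move=> w [n _ /=]; rewrite ltr_normr => /orP[?|?]; [left|right]; by exists n.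
Qed.
End maximal.

(** * Exchangeability of the observations *)

Section sample_space.
Context (R : realType) d1 (T1 : measurableType d1).

Definition rectangles : set (set (T1 * (nat -> R))) :=
  [set E | exists (A : set T1) (B : nat -> set R) (n : nat),
     [/\ measurable A, forall l, measurable (B l) &
         E = [set u | A u.1 /\ forall l, (l < n)%N -> B l (u.2 l)]]].

(** Laws of the mass partition together with the whole sequence of observations
    are compared on this space, generated by the finite-dimensional rectangles. *)
Definition sample := g_sigma_algebraType rectangles.

Lemma measurable_fun_sample d (T : measurableType d) (f : T -> sample) :
  measurable_fun setT (fun w => (f w).1) ->
  (forall l, measurable_fun setT (fun w => (f w).2 l)) ->
  measurable_fun setT f.
Proof.
move=> mf1 mf2; apply: (@measurability _ _ _ (sample : measurableType _) _ f rectangles) => //.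
move=> _ [_ [A [B [n [mA mB ->]]]] <-].
rewrite setTI [X in measurable X](_ : _ =
  (fun w => (f w).1) @^-1` A `&` \bigcap_(l in `I_n) ((fun w => (f w).2 l) @^-1` B l)).
  apply: measurableI; first by rewrite -[X in measurable X]setTI; exact: mf1.
  apply: fin_bigcap_measurable => // l _.
  by rewrite -[X in measurable X]setTI; exact: mf2.
by [].
Qed.

Lemma measurable_sample_fst : measurable_fun setT (fun u : sample => u.1).
Proof.
move=> _ A mA; rewrite setTI; apply: sub_sigma_algebra.
exists A, (fun=> setT), 0%N; split => //.
by apply/seteqP; split=> u //= [].
Qed.

Lemma measurable_sample_snd l : measurable_fun setT (fun u : sample => u.2 l).
Proof.
move=> _ B mB; rewrite setTI; apply: sub_sigma_algebra.
exists setT, (fun k => if k == l then B else setT), l.+1; split => //.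
  by move=> k; case: ifP.
apply/seteqP; split=> u /=.
  by move=> Bu; split=> // k _; case: eqP => // ->.
by case=> _ /(_ l (ltnSn l)); rewrite eqxx.
Qed.

Lemma setI_closed_rectangles : setI_closed rectangles.
Proof.
move=> _ _ [A [B [n [mA mB ->]]]] [A' [B' [n' [mA' mB' ->]]]].
exists (A `&` A'), (fun l => (if (l < n)%N then B l else setT) `&`
  (if (l < n')%N then B' l else setT)), (maxn n n'); split.
- exact: measurableI.
- by move=> l; apply: measurableI; case: ifP.
- apply/seteqP; split => u /=.
  + move=> [[Au Bu] [A'u B'u]]; split => // l _; split.
      by case: ifP => // /Bu.
    by case: ifP => // /B'u.
  + move=> [[Au A'u] Bu]; split; split => // l ln.
      have /Bu[] : (l < maxn n n')%N by rewrite leq_max ln.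
      by rewrite ln.
    have /Bu[] : (l < maxn n n')%N by rewrite leq_max ln orbT.
    by rewrite ln.
Qed.

End sample_space.

(** A permutation of the first n indices is given with its inverse, so that an
    observation can be located before and after the permutation. *)
Record perm_below (n : nat) (sigma tau : nat -> nat) : Prop := {
  perm_belowK : cancel sigma tau;
  perm_belowVK : cancel tau sigma;
  perm_below_id : forall l, (n <= l)%N -> sigma l = l }.

Lemma perm_belowV n sigma tau : perm_below n sigma tau -> perm_below n tau sigma.
Proof. by case=> K VK fx; split => // l nl; rewrite -{1}(fx l nl) K. Qed.

Lemma perm_below_ltn n sigma tau m l : perm_below n sigma tau -> (n <= m)%N ->
  (sigma l < m)%N = (l < m)%N.
Proof.
move=> pb nm; case: (leqP m l) => ml.
  by rewrite (perm_below_id pb) ?(leq_trans nm ml)// ltnNge ml.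
apply/negbNE/negP; rewrite -leqNgt => msl.
have := perm_below_id pb (leq_trans nm msl).
by move/(can_inj (perm_belowK pb)) => e; rewrite e leqNgt ml in msl.
Qed.

Lemma perm_below_iota n sigma tau m : perm_below n sigma tau -> (n <= m)%N ->
  perm_eq (map sigma (iota 0 m)) (iota 0 m).
Proof.
move=> pb nm; apply: uniq_perm; last 2 first.
- exact: iota_uniq.
- move=> l; rewrite mem_iota add0n leq0n/=; apply/mapP/idP.
    by move=> [k]; rewrite mem_iota add0n leq0n/= => km ->; rewrite (perm_below_ltn _ pb).
  move=> lm; exists (tau l); last by rewrite (perm_belowVK pb).
  by rewrite mem_iota/= (perm_below_ltn _ (perm_belowV pb)).
by rewrite map_inj_uniq ?iota_uniq//; exact: can_inj (perm_belowK pb).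
Qed.

Section exchangeability.
Context (R : realType) d1 (T1 : measurableType d1).
Context d (Omega : measurableType d) (PP : probability Omega R).
Variables (S : {RV PP >-> T1}) (X : nat -> {RV PP >-> R}).
Hypothesis X_id : forall l (B : set R), measurable B ->
  PP (X l @^-1` B) = PP (X 0%N @^-1` B).
Hypothesis indep : mutually_independent S X.
Local Open Scope ereal_scope.

Definition sampling (sigma : nat -> nat) (w : Omega) : sample R T1 :=
  (S w, fun l => X (sigma l) w).

Lemma measurable_sampling sigma : measurable_fun setT (sampling sigma).
Proof.
by apply: measurable_fun_sample => [|l]; exact: measurable_funPT.
Qed.

(** Permuting identically distributed independent observations permutes the
    factors of a product. *)
Lemma sampling_rectangle n sigma tau (A : set T1) (B : nat -> set R) m :
  perm_below n sigma tau -> (n <= m)%N -> measurable A ->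
  (forall l, measurable (B l)) ->
  PP (sampling sigma @^-1` [set u | A u.1 /\ forall l, (l < m)%N -> B l (u.2 l)]) =
  PP (S @^-1` A) * \prod_(l < m) PP (X 0%N @^-1` B l).
Proof.
move=> pb nm mA mB.
have -> : sampling sigma @^-1` [set u | A u.1 /\ forall l, (l < m)%N -> B l (u.2 l)]
   = S @^-1` A `&` \bigcap_(l < m) (X l @^-1` B (tau l)).
  apply/seteqP; split => w /= [Aw Bw]; split => // l /= lm.
    by have := Bw (tau l); rewrite (perm_belowVK pb) (perm_below_ltn _ (perm_belowV pb))//; apply.
  have := Bw (sigma l); rewrite /= (perm_belowK pb) (perm_below_ltn _ pb)//; exact.
rewrite indep//; congr (_ * _).
under eq_bigr do rewrite X_id//.
rewrite -(big_mkord xpredT (fun l => PP (X 0%N @^-1` B (tau l)))).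
rewrite -(big_mkord xpredT (fun l => PP (X 0%N @^-1` B l))) /index_iota subn0.
by rewrite -[RHS](perm_big _ (perm_below_iota (perm_belowV pb) nm))/= big_map.
Qed.

HB.instance Definition _ sigma := @isMeasurableFun.Build _ _ _ _
  (sampling sigma) (measurable_sampling sigma).

(** The two laws agree on rectangles, which are stable under intersection and
    generate. *)
Lemma sampling_exchangeable n sigma tau (E : set (sample R T1)) :
  perm_below n sigma tau -> measurable E ->
  PP (sampling sigma @^-1` E) = PP (sampling id @^-1` E).
Proof.
move=> pb mE.
apply: (@measure_unique _ R (sample R T1 : measurableType _) (@rectangles R d1 T1)
  (fun=> setT) _ _ _ _
  (pushforward PP (sampling sigma)) (pushforward PP (sampling id))) => //.
- exact: setI_closed_rectangles.
- move=> _; exists setT, (fun=> setT), 0%N; split => //.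
  by apply/seteqP; split.
- by rewrite bigcup_const//; exists 0%N.
- move=> _ [A [B [m [mA mB ->]]]]; rewrite /pushforward.
  pose B' l := if (l < m)%N then B l else setT.
  have -> : [set u : sample R T1 | A u.1 /\ forall l, (l < m)%N -> B l (u.2 l)] =
      [set u | A u.1 /\ forall l, (l < maxn n m)%N -> B' l (u.2 l)].
    apply/seteqP; split => u /= [Au Bu]; split => // l; rewrite /B'.
      by move=> _; case: ifP => // /Bu.
    by move=> lm; have := Bu l; rewrite /B' lm leq_max lm orbT; exact.
  have mB' l : measurable (B' l) by rewrite /B'; case: ifP.
  apply: etrans (sampling_rectangle pb (leq_maxl n m) mA mB') _.
  apply/esym; exact: (@sampling_rectangle 0%N id id).
- move=> _; change (PP (sampling sigma @^-1` setT) < +oo).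
  by rewrite preimage_setT probability_setT ltry.
Qed.

Lemma integral_exchangeable n sigma tau (f : sample R T1 -> \bar R) :
  perm_below n sigma tau -> measurable_fun setT f ->
  \int[PP]_w f (sampling sigma w) = \int[PP]_w f (sampling id w).
Proof.
move=> pb mf.
have key g : measurable_fun setT g -> (forall u, 0 <= g u) ->
    \int[PP]_w g (sampling sigma w) = \int[PP]_w g (sampling id w).
  move=> mg g0.
  have e s : \int[PP]_w g (sampling s w) = \int[pushforward PP (sampling s)]_u g u.
    rewrite ge0_integral_pushforward// ?preimage_setT//.
  rewrite !e; apply: (eq_measure_integral (pushforward PP (sampling id))) => A mA _.
  exact: (sampling_exchangeable pb mA).
change (\int[PP]_w (f \o sampling sigma) w = \int[PP]_w (f \o sampling id) w).
rewrite integralE [RHS]integralE.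
rewrite !(funepos_comp f (sampling _)) !(funeneg_comp f (sampling _)); congr (_ - _).
- exact: key (measurable_funepos mf) (funepos_ge0 f).
- exact: key (measurable_funeneg mf) (funeneg_ge0 f).
Qed.
End exchangeability.

(** * Sample means as a reversed martingale *)

Definition swap0 (l k : nat) : nat :=
  if k == 0%N then l else if k == l then 0%N else k.

Lemma perm_below_swap0 n l : (l < n)%N -> perm_below n (swap0 l) (swap0 l).
Proof.
move=> ln; have K : cancel (swap0 l) (swap0 l).
  move=> k; rewrite /swap0; case: (eqVneq k 0%N) => [->|k0].
    by case: (eqVneq l 0%N) => // _; rewrite eqxx.
  by case: (eqVneq k l) => [->|kl]; rewrite ?eqxx// (negbTE k0) (negbTE kl).
split => // k nk; rewrite /swap0; case: (eqVneq k 0%N) => [k0|_].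
  by move: (leq_trans ln nk); rewrite k0.
by case: eqVneq => // kl; move: (leq_trans ln nk); rewrite kl ltnn.
Qed.

Section exchangeable_means.
Context (R : realType) d1 (T1 : measurableType d1).
Context d (Omega : measurableType d) (PP : probability Omega R).
Variables (S : {RV PP >-> T1}) (X : nat -> {RV PP >-> R}).
Hypothesis X_id : forall l (B : set R), measurable B ->
  PP (X l @^-1` B) = PP (X 0%N @^-1` B).
Hypothesis indep : mutually_independent S X.
Local Open Scope ereal_scope.

(** These families decrease with n.  By exchangeability all of the first n
    observations have the same conditional expectation given the n-th family,
    hence so has their mean. *)
Definition symmetric_events (n : nat) : set (set Omega) :=
  [set A | exists E : set (sample R T1), [/\ measurable E,
     A = sampling S X id @^-1` E &
     forall sigma tau, perm_below n sigma tau -> forall u : sample R T1,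
       E (u.1, u.2 \o sigma) <-> E u]].

Lemma subalgebra_symmetric_events n : subalgebra (symmetric_events n).
Proof.
split.
- move=> _ [E [mE -> _]]; rewrite -[X in measurable X]setTI.
  exact: measurable_sampling.
- move=> _ _ [E [mE -> sE]] [E' [mE' -> sE']]; exists (E `|` E'); split => //.
    exact: measurableU.
  by move=> s t st u; rewrite /setU/= (sE s t st u) (sE' s t st u).
- move=> _ _ [E [mE -> sE]] [E' [mE' -> sE']]; exists (E `\` E'); split => //.
    exact: measurableD.
  by move=> s t st u; rewrite /setD/= (sE s t st u) (sE' s t st u).
Qed.

Lemma symmetric_events_nonincr :
  {homo symmetric_events : n m / (m <= n)%N >-> n `<=` m}.
Proof.
move=> n m mn A [E [mE -> sE]]; exists E; split => // s t [K VK fx].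
by apply: sE; split=> // l nl; apply: fx; exact: leq_trans nl.
Qed.

Definition observe (f : T1 * R -> R) (l : nat) (w : Omega) : R := f (S w, X l w).

Lemma measurable_sample_observe (f : T1 * R -> R) l : measurable_fun setT f ->
  measurable_fun setT (fun u : sample R T1 => f (u.1, u.2 l)).
Proof.
move=> mf; apply: (measurableT_comp mf).
by apply: measurable_fun_pair; [exact: measurable_sample_fst|exact: measurable_sample_snd].
Qed.

Lemma measurable_observe (f : T1 * R -> R) l : measurable_fun setT f ->
  measurable_fun setT (observe f l).
Proof.
move=> mf.
by apply: (measurableT_comp mf); apply: measurable_fun_pair; exact: measurable_funPT.
Qed.

(** Exchanging the individuals 0 and l preserves both the law and the event. *)
Lemma integral_observe_symmetric (f : T1 * R -> R) n A l : measurable_fun setT f ->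
  symmetric_events n A -> (l < n)%N ->
  \int[PP]_(w in A) (observe f l w)%:E = \int[PP]_(w in A) (observe f 0 w)%:E.
Proof.
move=> mf [E [mE -> sE]] ln.
pose g := (fun u : sample R T1 => (f (u.1, u.2 0%N))%:E) \_ E.
have mg : measurable_fun setT g.
  apply/(measurable_restrictT _ mE); apply: measurable_funTS.
  by apply/measurable_EFinP; exact: measurable_sample_observe.
have := integral_exchangeable X_id indep (perm_below_swap0 ln) mg.
move=> H; rewrite [LHS]integral_mkcond [RHS]integral_mkcond.
transitivity (\int[PP]_w g (sampling S X (swap0 l) w)).
  apply: eq_integral => w _; rewrite /g !patchE.
  have -> // : (w \in sampling S X id @^-1` E) = (sampling S X (swap0 l) w \in E).
  apply/idP/idP; rewrite !inE /=.
    by move/(sE _ _ (perm_below_swap0 ln)).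
  by move=> h; apply/(sE _ _ (perm_below_swap0 ln)).
by rewrite H; apply: eq_integral => w _; rewrite /g !patchE.
Qed.

Variable f : T1 * R -> R.
Hypothesis mf : measurable_fun setT f.

Definition sample_mean (n : nat) (w : Omega) : R :=
  ((\sum_(l < n) observe f l w) / n%:R)%R.

Lemma measurable_sample_mean n : measurable_fun setT (sample_mean n).
Proof.
apply: measurable_funM => //; apply: measurable_sum => i; exact: measurable_observe.
Qed.

Hypothesis if0 : PP.-integrable setT (EFin \o observe f 0).

Lemma integrable_observe l : PP.-integrable setT (EFin \o observe f l).
Proof.
apply/integrableP; split; first by apply: measurableT_comp => //; exact: measurable_observe.
have mnf : measurable_fun setT (fun p => `|f p|%R) by exact: measurableT_comp.
have := @integral_observe_symmetric _ l.+1 setT l mnf _ (ltnSn l).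
rewrite /observe/= => ->; first by case/integrableP: if0.
by exists setT; split.
Qed.

Lemma integrable_sample_mean n : PP.-integrable setT (EFin \o sample_mean n).
Proof.
rewrite (_ : _ \o _ = fun w => (n%:R^-1)%:E * \sum_(l < n) (observe f l w)%:E).
  apply: integrableZl => //; apply: integrable_sum => // i _; exact: integrable_observe.
by apply/funext => w; rewrite /= sumEFin -EFinM mulrC.
Qed.

Lemma integral_sample_mean_symmetric n A : symmetric_events n A -> (0 < n)%N ->
  \int[PP]_(w in A) (sample_mean n w)%:E = \int[PP]_(w in A) (observe f 0 w)%:E.
Proof.
move=> sA n0; have mA := subalgebra_measurable (subalgebra_symmetric_events n) sA.
have iA l : PP.-integrable A (EFin \o observe f l).
  by apply: integrableS (integrable_observe l).
rewrite (eq_integral (fun w => (n%:R^-1)%:E * \sum_(l < n) (observe f l w)%:E)); last first.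
  by move=> w _; rewrite /= sumEFin -EFinM mulrC.
rewrite integralZl//; last by apply: integrable_sum => // i _; exact: iA.
rewrite integral_sum//; last by move=> i; exact: iA.
under eq_bigr => i _ do rewrite (integral_observe_symmetric mf sA (ltn_ord i)).
have /fineK <- : \int[PP]_(w in A) (observe f 0 w)%:E \is a fin_num.
  by apply: integrable_fin_num => //; exact: (iA 0%N).
rewrite sumEFin -EFinM sumr_const card_ord -(mulr_natl (fine _)) mulrA mulVf ?mul1r//.
by rewrite pnatr_eq0 -lt0n.
Qed.

Lemma symmetric_sample_mean_gt n lam :
  symmetric_events n [set w | (lam < sample_mean n w)%R].
Proof.
exists [set u : sample R T1 | (lam < (\sum_(l < n) f (u.1, u.2 l)) / n%:R)%R]; split => //.
  apply: measurable_set_gt; apply: measurable_funM => //; apply: measurable_sum => i.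
  exact: measurable_sample_observe.
move=> sigma tau pb u /=.
rewrite -(big_mkord xpredT (fun l => f (u.1, u.2 l))).
rewrite -(big_mkord xpredT (fun l => f (u.1, u.2 (sigma l)))) /index_iota subn0.
by rewrite -[in X in _ <-> X](perm_big _ (perm_below_iota pb (leqnn n)))/= big_map.
Qed.

(** The means from time m on are a reversed martingale, so that their supremum is
    controlled by the mean at time m alone. *)
Lemma maximal_sample_mean_gt (m : nat) (lam : R) : (0 <= lam)%R -> (0 < m)%N ->
  lam%:E * PP (\bigcup_k [set w | (lam < sample_mean (m + k) w)%R]) <=
  \int[PP]_w `|(sample_mean m w)%:E|.
Proof.
move=> lam0 m0.
apply: (@maximal_gt_reverse _ _ _ PP (fun k => symmetric_events (m + k)) (sample_mean m)
  (fun k => sample_mean (m + k)) lam lam0).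
- by move=> n; exact: subalgebra_symmetric_events.
- by move=> n k kn; apply: symmetric_events_nonincr; rewrite leq_add2l.
- exact: integrable_sample_mean.
- by move=> n; exact: integrable_sample_mean.
- by move=> n; exact: symmetric_sample_mean_gt.
- move=> n A sA; rewrite integral_sample_mean_symmetric// ?addn_gt0 ?m0//.
  rewrite integral_sample_mean_symmetric//.
  by apply: symmetric_events_nonincr sA; rewrite leq_addr.
Qed.

End exchangeable_means.

(** * From maximal inequalities to almost sure statements *)

Section almost_sure.
Context d (T : measurableType d) (R : realType) (mu : probability T R).
Local Open Scope ereal_scope.

(** For fixed e the intersection of the A e m over m is null; monotonicity in e
    leaves countably many e to consider. *)
Lemma ae_exists_notin (A : R -> nat -> set T) :
  (forall e m, measurable (A e m)) ->
  (forall e e' m, (e <= e')%R -> A e' m `<=` A e m) ->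
  (forall e eta : R, (0 < e)%R -> (0 < eta)%R -> exists m, mu (A e m) <= eta%:E) ->
  {ae mu, forall w, forall e : R, (0 < e)%R -> exists m, ~ A e m w}.
Proof.
move=> mA decA smallA.
have : {ae mu, forall w, forall j : nat, exists m, ~ A (j.+1%:R^-1)%R m w}.
  apply: ae_foralln => j.
  have mI : measurable (\bigcap_m A (j.+1%:R^-1)%R m) by exact: bigcapT_measurable.
  exists (\bigcap_m A (j.+1%:R^-1)%R m); split => //; last first.
    move=> w /= nw m _; apply: contrapT => nA; apply: nw; by exists m.
  apply/eqP; rewrite -measure_le0; apply/lee_addgt0Pr => eta eta0; rewrite add0e.
  have jp : (0 < j.+1%:R^-1 :> R)%R by rewrite invr_gt0.
  have [m Am] := smallA _ eta jp eta0.
  apply: le_trans Am; apply: le_measure; rewrite ?inE// => w; exact.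
apply: filterS => w H e e0.
have [j je] : exists j : nat, (j.+1%:R^-1 < e)%R.
  by have [j _ /(_ _ (leqnn j))] := near_infty_natSinv_lt (PosNum e0); exists j.
by have [m nA] := H j; exists m => /(decA _ _ m (ltW je)).
Qed.

Lemma ae_cvg0_of_tail (Z : nat -> T -> R) :
  (forall n, measurable_fun setT (Z n)) ->
  (forall e eta : R, (0 < e)%R -> (0 < eta)%R ->
     exists m, mu (\bigcup_k [set w | (e < `|Z (m + k)%N w|)%R]) <= eta%:E) ->
  {ae mu, forall w, Z n w @[n --> \oo] --> (0 : R)%R}.
Proof.
move=> mZ H.
have := @ae_exists_notin (fun e m => \bigcup_k [set w | (e < `|Z (m + k)%N w|)%R]) _ _ H.
have h1 (e : R) m : measurable (\bigcup_k [set w | (e < `|Z (m + k)%N w|)%R]).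
  apply: bigcupT_measurable => k; apply: measurable_set_gt.
  exact: measurableT_comp.
have h2 (e e' : R) m : (e <= e')%R -> \bigcup_k [set w | (e' < `|Z (m + k)%N w|)%R] `<=`
    \bigcup_k [set w | (e < `|Z (m + k)%N w|)%R].
  by move=> ee' w [k _ /= lt]; exists k => //=; exact: le_lt_trans lt.
move=> /(_ h1 h2); apply: filterS => w Hw.
apply/cvgr0Pnorm_le => e e0; have [m nm] := Hw e e0.
near=> n.
have mn : (m <= n)%N by near: n; exists m.
rewrite leNgt; apply/negP => lt; apply: nm; exists (n - m)%N => //=.
by rewrite subnKC.
Unshelve. all: by end_near.
Qed.
End almost_sure.

Section uniform.
Context (R : realType).

Lemma uniform_prob01 (U : set R) : measurable U ->
  uniform_prob (@ltr01 R) U = lebesgue_measure (U `&` `[0%R, 1%R]).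
Proof.
move=> mU; rewrite /uniform_prob integral_uniform_pdf.
rewrite (eq_integral (cst 1%E)).
  by rewrite integral_cst ?mul1e//; exact: measurableI.
move=> x; rewrite inE/= => -[_]; rewrite in_itv/= /uniform_pdf => ->.
by rewrite subr0 invr1.
Qed.

(** The distribution function of the uniform law on [0, 1]. *)
Definition clip (q : R) : R := Num.min (Num.max q 0) 1.

Lemma uniform_prob_lt (q : R) :
  uniform_prob (@ltr01 R) [set x | (x < q)%R] = (clip q)%:E.
Proof.
have E : [set x | (x < q)%R] = `]-oo, q[%classic by rewrite set_itvE.
rewrite uniform_prob01 E//.
have [q0|q0] := leP q 0%R.
  rewrite (_ : _ `&` _ = set0).
    by rewrite measure0 /clip max_r// min_l.
  apply/seteqP; split => x //=; rewrite !in_itv/= => -[xq /andP[x0 _]].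
  by have := lt_le_trans xq (le_trans q0 x0); rewrite ltxx.
have [q1|q1] := leP q 1%R.
  rewrite (_ : _ `&` _ = `[0%R, q[%classic).
    by rewrite lebesgue_measure_itv/= lte_fin q0 sube0 /clip max_l ?min_l// ltW.
  apply/seteqP; split => x /=; rewrite !in_itv/=; first by move=> [-> /andP[-> _]].
  by move=> /andP[-> xq]; rewrite xq/= (ltW (lt_le_trans xq q1)).
rewrite (_ : _ `&` _ = `[0%R, 1%R]%classic).
  rewrite lebesgue_measure_itv/= lte_fin ltr01 sube0 /clip max_l ?min_r//; exact: ltW.
apply/seteqP; split => x /=; rewrite !in_itv/=; first by case.
by move=> /andP[-> x1]; rewrite x1; split => //; exact: le_lt_trans q1.
Qed.

Lemma uniform_prob_subitv (a b : R) : a <= b -> `]a, b[%classic `<=` `[0, 1]%classic ->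
  uniform_prob (@ltr01 R) `]a, b[%classic = (b - a)%:E.
Proof.
move=> ab sub; rewrite uniform_prob01// setIidl// lebesgue_measure_itv/= lte_fin.
by move: ab; rewrite le_eqVlt => /predU1P[->|->]; rewrite ?ltxx ?subrr// EFinB.
Qed.
End uniform.

(** * Law of large numbers for the empirical distribution function *)

Lemma integral_cst_probability d (T : measurableType d) (R : realType)
    (mu : probability T R) (c : \bar R) : (\int[mu]_w c = c)%E.
Proof.
by rewrite -[RHS]mule1 -(probability_setT mu); exact: integral_cst.
Qed.

Lemma integrable_le_cst d (T : measurableType d) (R : realType)
    (mu : probability T R) (f : T -> R) (K : R) : measurable_fun setT f ->
  (forall w, `|f w| <= K) -> mu.-integrable setT (EFin \o f).
Proof.
move=> mf fK.
apply: (@le_integrable _ _ _ mu setT measurableT _ (fun=> K%:E)).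
- exact/measurable_EFinP.
- by move=> w _; rewrite /= lee_fin (le_trans (fK w))// ler_norm.
- exact: finite_measure_integrable_cst.
Qed.

Lemma normr_le_add_sqr (R : realFieldType) (x e : R) : 0 < e ->
  `|x| <= e + e^-1 * x ^+ 2.
Proof.
move=> e0; rewrite -(ler_pM2l e0) mulrDr mulrA divff ?gt_eqF// mul1r.
rewrite -[x ^+ 2]real_normK ?num_real//; nra.
Qed.

Section sample_mean_cvg.
Context (R : realType) d1 (T1 : measurableType d1).
Context d (Omega : measurableType d) (PP : probability Omega R).
Variables (S : {RV PP >-> T1}) (X : nat -> {RV PP >-> R}).
Hypothesis X_id : forall l (B : set R), measurable B ->
  PP (X l @^-1` B) = PP (X 0%N @^-1` B).
Hypothesis indep : mutually_independent S X.
Local Open Scope ereal_scope.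

Lemma maximal_sample_mean (f : T1 * R -> R) (m : nat) (lam : R) :
  measurable_fun setT f -> PP.-integrable setT (EFin \o observe S X f 0) ->
  (0 <= lam)%R -> (0 < m)%N ->
  lam%:E * PP (\bigcup_k [set w | (lam < `|sample_mean S X f (m + k) w|)%R]) <=
  2%:E * \int[PP]_w `|(sample_mean S X f m w)%:E|.
Proof.
move=> mf if0 lam0 m0.
have mNf : measurable_fun setT (fun p => - f p)%R by exact: measurableT_comp.
have smN n w : sample_mean S X (fun p => - f p)%R n w = (- sample_mean S X f n w)%R.
  by rewrite /sample_mean /observe sumrN mulNr.
have iNf : PP.-integrable setT (EFin \o observe S X (fun p => - f p)%R 0).
  rewrite (_ : _ \o _ = (\- (EFin \o observe S X f 0))); first exact: integrableN.
  by apply/funext => w /=; rewrite EFinN.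
have H1 := maximal_sample_mean_gt X_id indep mf if0 lam0 m0.
have H2 := maximal_sample_mean_gt X_id indep mNf iNf lam0 m0.
have msm k := measurable_sample_mean S X mf (m + k)%N.
apply: le_trans (lee_wpmul2l _ (measure_bigcup_gt_normr PP lam msm)) _.
  by rewrite lee_fin.
rewrite ge0_muleDr// (_ : 2%:E = 1 + 1); last by rewrite -EFinD.
rewrite ge0_muleDl// mul1e.
apply: leeD => //; move: H2; under [X in _ * PP X <= _ -> _]eq_bigcupr => k _.
  rewrite (_ : [set w | _] = [set w | (lam < - sample_mean S X f (m + k) w)%R]); last first.
    by apply/seteqP; split=> w/=; rewrite smN.
  over.
move=> H2; apply: (le_trans H2); rewrite le_eqVlt; apply/orP; left; apply/eqP.
by apply: eq_integral => w _; rewrite smN EFinN abseN.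
Qed.

(** Convergence to 0 in L1 is upgraded to almost sure convergence by the maximal
    inequality. *)
Lemma cvg_sample_mean0 (f : T1 * R -> R) :
  measurable_fun setT f -> PP.-integrable setT (EFin \o observe S X f 0) ->
  (forall eta : R, (0 < eta)%R -> exists2 m, (0 < m)%N &
     \int[PP]_w `|(sample_mean S X f m w)%:E| <= eta%:E) ->
  {ae PP, forall w, sample_mean S X f n w @[n --> \oo] --> (0 : R)%R}.
Proof.
move=> mf if0 H; apply: ae_cvg0_of_tail; first exact: measurable_sample_mean.
move=> e eta e0 eta0.
have [|m m0 Hm] := H (e * eta / 2)%R; first by rewrite divr_gt0// mulr_gt0.
exists m; rewrite -(@lee_pmul2l _ e%:E)// ?lte_fin// -EFinM.
apply: le_trans (maximal_sample_mean mf if0 (ltW e0) m0) _.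
rewrite (_ : (e * eta)%R = 2 * (e * eta / 2))%R ?EFinM; last by field.
by apply: lee_wpmul2l.
Qed.
End sample_mean_cvg.

Section glivenko_cantelli.
Context (R : realType) d1 (T1 : measurableType d1).
Context d (Omega : measurableType d) (PP : probability Omega R).
Variables (S : {RV PP >-> T1}) (X : nat -> {RV PP >-> R}).
Hypothesis X_unif : forall l (B : set R), measurable B ->
  PP (X l @^-1` B) = uniform_prob (@ltr01 R) B.
Hypothesis indep : mutually_independent S X.

Let X_id l (B : set R) : measurable B -> PP (X l @^-1` B) = PP (X 0%N @^-1` B).
Proof. by move=> mB; rewrite !X_unif. Qed.

Lemma pairwise_independent l k (B : set R) : measurable B -> l != k ->
  (PP (X l @^-1` B `&` X k @^-1` B) = PP (X l @^-1` B) * PP (X k @^-1` B))%E.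
Proof.
move=> mB lk; pose B' i := if (i == l) || (i == k) then B else setT.
have mB' i : measurable (B' i) by rewrite /B'; case: ifP.
have ln : (l < (maxn l k).+1)%N by rewrite ltnS leq_maxl.
have kn : (k < (maxn l k).+1)%N by rewrite ltnS leq_maxr.
have := indep (maxn l k).+1 (measurableT : measurable [set: T1]) mB'.
rewrite preimage_setT setTI probability_setT mul1e => H.
rewrite (_ : _ `&` _ = \bigcap_(i < (maxn l k).+1) (X i @^-1` B' i)).
  rewrite H (bigD1 (Ordinal ln))//= (bigD1 (Ordinal kn))/=; last first.
    by rewrite -val_eqE/= eq_sym.
  rewrite /B' !eqxx orbT/= big1 ?mule1// => i /andP[].
  rewrite -!val_eqE/= => /negbTE -> /negbTE ->.
  by rewrite preimage_setT probability_setT.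
apply/seteqP; split => w /=.
  by move=> [Bl Bk] i _; rewrite /B'; case: ifP => // /orP[/eqP->|/eqP->].
by move=> Bw; split; [have := Bw l ln|have := Bw k kn]; rewrite /B' /= eqxx ?orbT.
Qed.

Definition below (q : R) (p : T1 * R) : R := \1_[set y | y < q] p.2 - clip q.

Lemma measurable_below q : measurable_fun setT (below q).
Proof.
apply: measurable_funB => //; apply: (measurableT_comp _ measurable_snd).
by apply: measurable_indic; rewrite -set_itvNyo.
Qed.

Lemma clip_itv (q : R) : 0 <= clip q <= 1.
Proof. by rewrite /clip le_min ler01 le_max lexx orbT/= ge_min lexx orbT. Qed.

Lemma normr_below_le1 q p : `|below q p| <= 1.
Proof.
rewrite /below indicE; have /andP[c0 c1] := clip_itv q.
case: (_ \in _); rewrite /= ?mulr1n ?mulr0n ler_norml; apply/andP; split; lra.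
Qed.

Local Notation W q l := (observe S X (below q) l).

(** Pairwise independence makes the centred indicators orthogonal. *)
Lemma integral_below_mul q l k : l != k ->
  (\int[PP]_w (W q l w * W q k w)%:E = 0)%E.
Proof.
move=> lk; set c := clip q.
pose A l := X l @^-1` [set y | y < q].
have mq : measurable [set y : R | y < q].
  by rewrite -set_itvNyo.
have mA i : measurable (A i) by rewrite -[X in measurable X]setTI; exact: measurable_funPT.
have PA i : PP (A i) = c%:E by rewrite X_unif// uniform_prob_lt.
have PAA : PP (A l `&` A k) = (c * c)%:E.
  by rewrite pairwise_independent// -/(A l) -/(A k) !PA EFinM.
have i1 B : measurable B -> PP.-integrable setT (EFin \o (\1_B : Omega -> R)).
  move=> mB; apply: (@integrable_le_cst _ _ _ _ _ 1); first exact: measurable_indic.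
  by move=> w; rewrite indicE; case: (_ \in _); rewrite ?normr1 ?normr0.
have ic (r : R) : PP.-integrable setT (EFin \o (fun=> r)).
  exact: finite_measure_integrable_cst.
have i12 : PP.-integrable setT (fun w => (\1_(A l) w + \1_(A k) w : R)%:E).
  exact: (integrableD measurableT (i1 _ (mA l)) (i1 _ (mA k))).
pose g1 w : R := \1_(A l `&` A k) w + c * c.
pose g2 w : R := c * (\1_(A l) w + \1_(A k) w).
rewrite (eq_integral (fun w => (g1 w)%:E - (g2 w)%:E)%E); last first.
  move=> w _; rewrite -EFinB; congr EFin; rewrite /g1 /g2 /observe /below/= !indicE.
  have eA i : (w \in A i) = (X i w < q) by apply/idP/idP; rewrite inE.
  have eB i : (X i w \in [set y | y < q]) = (X i w < q) by apply/idP/idP; rewrite inE.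
  rewrite in_setI !eA !eB -/c.
  by case: (X l w < q); case: (X k w < q) => /=; lra.
have E1 : (\int[PP]_w (g1 w)%:E = (c * c + c * c)%:E)%E.
  rewrite (integralD_EFin _ (i1 _ _) (ic (c * c)))//; last exact: measurableI.
  rewrite integral_indic// ?setIT; last exact: measurableI.
  rewrite EFinD; congr (_ + _)%E; first exact: PAA.
  exact: integral_cst_probability.
have E2 : (\int[PP]_w (g2 w)%:E = (c * (c + c))%:E)%E.
  rewrite (eq_integral (fun w => c%:E * (\1_(A l) w + \1_(A k) w)%:E)%E)//.
  rewrite integralZl//.
  rewrite (integralD_EFin _ (i1 _ _) (i1 _ _))// !integral_indic// !setIT EFinM EFinD.
  by congr (_ * (_ + _))%E; exact: PA.
rewrite integralB_EFin// ?E1 ?E2 -?EFinB.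
- by congr EFin; lra.
- exact: (integrableD measurableT (i1 _ (measurableI _ _ (mA l) (mA k))) (ic _)).
- exact: (integrableZl measurableT c i12).
Qed.

(** By orthogonality the second moment of the mean is at most 1/m; the bound
    |x| <= delta + x^2 / delta turns it into a bound of the first moment. *)
Lemma integral_sample_mean_below q (delta : R) m : (0 < m)%N -> 0 < delta ->
  (\int[PP]_w `|(sample_mean S X (below q) m w)%:E| <=
   (delta + (m%:R * delta)^-1)%:E)%E.
Proof.
move=> m0 d0; pose M := sample_mean S X (below q) m.
have mW l : measurable_fun setT (W q l) by apply: measurable_observe; exact: measurable_below.
have mM : measurable_fun setT M by apply: measurable_sample_mean; exact: measurable_below.
have iWW l k : PP.-integrable setT (fun w => (W q l w * W q k w)%:E).
  apply: (@integrable_le_cst _ _ _ _ _ 1); first exact: measurable_funM.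
  move=> w; rewrite normrM -[leRHS]mulr1.
  by apply: ler_pM => //; exact: normr_below_le1.
have iS l : PP.-integrable setT (fun w => \sum_(k < m) (W q l w * W q k w)%:E)%E.
  by apply: integrable_sum => // k _; exact: iWW.
have M2E w : ((M w) ^+ 2)%:E = ((m%:R ^- 2)%:E *
    \sum_(l < m) \sum_(k < m) (W q l w * W q k w)%:E)%E.
  under eq_bigr do rewrite sumEFin; rewrite sumEFin -EFinM; congr EFin.
  rewrite /M /sample_mean expr_div_n mulrC; congr (_ * _); rewrite expr2 mulr_suml.
  by apply: eq_bigr => l _; rewrite mulr_sumr.
have M2 : (\int[PP]_w ((M w) ^+ 2)%:E <= (m%:R^-1)%:E)%E.
  under eq_integral do rewrite M2E.
  rewrite integralZl//; last by apply: integrable_sum => // l _; exact: iS.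
  rewrite integral_sum//.
  apply: (@le_trans _ _ ((m%:R ^- 2)%:E * \sum_(l < m) 1%:E)%E).
    apply: lee_wpmul2l; first by rewrite lee_fin invr_ge0 exprn_ge0.
    apply: lee_sum => l _; rewrite integral_sum//.
    rewrite (bigD1 l)//= big1 ?adde0; last first.
      by move=> k kl; apply: integral_below_mul; rewrite eq_sym; exact: kl.
    apply: (@le_trans _ _ (\int[PP]_w (cst 1%:E) w)%E).
      apply: le_integral => //; first exact: finite_measure_integrable_cst.
      move=> w _; rewrite lee_fin (le_trans (ler_norm _))// normrM -[leRHS]mulr1.
      by apply: ler_pM => //; exact: normr_below_le1.
    by rewrite integral_cst_probability.
  rewrite sumEFin sumr_const card_ord -EFinM lee_fin.
  have mn0 : m%:R != 0 :> R by rewrite pnatr_eq0 -lt0n.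
  by rewrite le_eqVlt; apply/orP; left; apply/eqP; field.
have iM2 : PP.-integrable setT (fun w => ((M w) ^+ 2)%:E).
  under eq_fun do rewrite M2E.
  by apply: integrableZl => //; apply: integrable_sum => // l _; exact: iS.
apply: (@le_trans _ _ (\int[PP]_w (delta%:E + (delta^-1)%:E * ((M w) ^+ 2)%:E))%E).
  apply: ge0_le_integral => //.
  - by apply/measurable_EFinP; exact: measurableT_comp.
  - by apply: emeasurable_funD => //; apply: measurable_funeM; case/integrableP: iM2.
  - move=> w _; rewrite -EFinM -EFinD lee_fin -/(M w); exact: normr_le_add_sqr.
rewrite ge0_integralD//; last 3 first.
- by move=> w _; rewrite lee_fin ltW.
- by move=> w _; rewrite -EFinM lee_fin mulr_ge0 ?invr_ge0 ?(ltW d0)// sqr_ge0.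
- by apply: measurable_funeM; case/integrableP: iM2.
rewrite integral_cst_probability integralZl// EFinD; apply: leeD => //.
rewrite invfM mulrC EFinM; apply: lee_wpmul2l => //.
by rewrite lee_fin invr_ge0 ltW.
Qed.
End glivenko_cantelli.

(** * Frequencies of intervals *)

Lemma le_natr_boolB (R : realFieldType) (i b1 b2 : bool) :
  (i -> b2 && ~~ b1) -> (b1 -> b2) -> i%:R <= b2%:R - b1%:R :> R.
Proof.
by case: i; case: b1; case: b2 => h1 h2; try (by have := h1 isT);
  try (by have := h2 isT); rewrite /=; lra.
Qed.

Lemma ge_natr_boolB (R : realFieldType) (i b1 b2 : bool) :
  (b2 -> ~~ b1 -> i) -> b2%:R - b1%:R <= i%:R :> R.
Proof.
by case: i; case: b1; case: b2 => h; try (by have := h isT isT); rewrite /=; lra.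
Qed.

Section interval_frequency.
Context (R : realType).

Definition interval_frequency (I : set R) (x : nat -> R) (n : nat) : R :=
  (\sum_(l < n) \1_I (x l)) / n%:R.

(** The frequency of an open interval is squeezed between increments of the
    empirical distribution function at rational points close to the endpoints. *)
Lemma cvg_interval_frequency (x : nat -> R) (a b : R) :
  (forall q : rat, (\sum_(l < n) (\1_[set y | y < ratr q] (x l) - clip (ratr q))) / n%:R
     @[n --> \oo] --> (0 : R)) ->
  a <= b -> `]a, b[%classic `<=` `[0, 1]%classic ->
  interval_frequency `]a, b[%classic x n @[n --> \oo] --> b - a.
Proof.
move=> H; rewrite le_eqVlt => /predU1P[->|ab] sub.
  rewrite subrr (_ : interval_frequency _ _ = fun=> 0); first exact: cvg_cst.
  apply/funext => n; rewrite /interval_frequency big1 ?mul0r// => l _.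
  by rewrite set_itv_ge ?indic0// bnd_simp ltxx.
have a0 : 0 <= a.
  rewrite leNgt; apply/negP => a0.
  have m1 : a < Num.min b 0 by rewrite lt_min ab.
  have := sub ((a + Num.min b 0) / 2); rewrite /= !in_itv/= midf_lt//=.
  have m2 : Num.min b 0 <= b by rewrite ge_min lexx.
  have m3 : Num.min b 0 <= 0 by rewrite ge_min lexx orbT.
  have -> : (a + Num.min b 0) / 2 < b by have := midf_lt m1 => -[_]; lra.
  by move=> /(_ isT) /andP[]; lra.
have b1 : b <= 1.
  rewrite leNgt; apply/negP => b1.
  have m1 : Num.max a 1 < b by rewrite gt_max ab.
  have m2 : a <= Num.max a 1 by rewrite le_max lexx.
  have m3 : 1 <= Num.max a 1 by rewrite le_max lexx orbT.
  have := sub ((Num.max a 1 + b) / 2); rewrite /= !in_itv/=.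
  have -> : a < (Num.max a 1 + b) / 2 by lra.
  have -> : (Num.max a 1 + b) / 2 < b by lra.
  by move=> /(_ isT) /andP[]; lra.
pose G q n : R := (\sum_(l < n) \1_[set y | y < q] (x l)) / n%:R.
have GH (q : rat) e : 0 < e -> \forall n \near \oo, `|G (ratr q) n - clip (ratr q)| <= e.
  move=> e0; have /cvgr0Pnorm_le /(_ e e0) := H q; apply: filter_app.
  near=> n; have n0 : n%:R != 0 :> R by rewrite pnatr_eq0 -lt0n; near: n; exists 1%N.
  rewrite sumrB mulrBl sumr_const card_ord -(mulr_natl (clip _)).
  rewrite [in X in _ - X]mulrAC divff// mul1r.
  exact.
apply/cvgrPdist_le => e e0.
have e4 : 0 < e / 4 by rewrite divr_gt0.
(* q1 < a and b < q2 bound the interval from outside, a < q3 and q4 < b from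
   inside *)
have [q1 /andP[q1l q1r]] : exists q : rat, a - e / 4 < ratr q < a.
  by have [q] := @rat_in_itvoo R (a - e / 4) a (ltac:(lra)); rewrite in_itv/=; exists q.
have [q2 /andP[q2l q2r]] : exists q : rat, b < ratr q < b + e / 4.
  by have [q] := @rat_in_itvoo R b (b + e / 4) (ltac:(lra)); rewrite in_itv/=; exists q.
have [q3 /andP[q3l q3r]] : exists q : rat, a < ratr q < a + e / 4.
  by have [q] := @rat_in_itvoo R a (a + e / 4) (ltac:(lra)); rewrite in_itv/=; exists q.
have [q4 /andP[q4l q4r]] : exists q : rat, b - e / 4 < ratr q < b.
  by have [q] := @rat_in_itvoo R (b - e / 4) b (ltac:(lra)); rewrite in_itv/=; exists q.
have c1 : ratr q1 <= clip (ratr q1 : R).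
  by rewrite /clip le_min le_max lexx/= (le_trans (ltW q1r))// (le_trans (ltW ab)).
have c2 : clip (ratr q2) <= ratr q2 :> R.
  by rewrite /clip ge_min ge_max lexx/= (le_trans _ (ltW q2l))// (le_trans a0 (ltW ab)).
have c3 : clip (ratr q3) <= ratr q3 :> R.
  by rewrite /clip ge_min ge_max lexx/= (le_trans _ (ltW q3l)).
have c4 : ratr q4 <= clip (ratr q4 : R).
  by rewrite /clip le_min le_max lexx/= (le_trans (ltW q4r)).
have eB q i : (x i \in [set y | y < q]) = (x i < q) by apply/idP/idP; rewrite inE.
have eI i : (x i \in `]a, b[%classic) = (a < x i < b).
  by apply/idP/idP; rewrite inE/= in_itv.
near=> n.
have n0 : 0 <= n%:R^-1 :> R by rewrite invr_ge0.
have u : interval_frequency `]a, b[%classic x n <= G (ratr q2) n - G (ratr q1) n.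
  rewrite /interval_frequency /G -mulrBl -sumrB; apply: ler_wpM2r => //.
  apply: ler_sum => l _; rewrite !indicE !eB eI.
  apply: le_natr_boolB => [/andP[ax xb]|xq1].
    by rewrite -leNgt (lt_trans xb q2l) (ltW (lt_trans q1r ax)).
  by rewrite (lt_trans xq1) ?(lt_trans q1r) ?(lt_trans ab).
have v : G (ratr q4) n - G (ratr q3) n <= interval_frequency `]a, b[%classic x n.
  rewrite /interval_frequency /G -mulrBl -sumrB; apply: ler_wpM2r => //.
  apply: ler_sum => l _; rewrite !indicE !eB eI.
  apply: ge_natr_boolB => xq4; rewrite -leNgt => q3x.
  by rewrite (lt_le_trans q3l q3x) (lt_trans xq4 q4r).
have : `|G (ratr q1) n - clip (ratr q1)| <= e / 4 by near: n; exact: GH.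
have : `|G (ratr q2) n - clip (ratr q2)| <= e / 4 by near: n; exact: GH.
have : `|G (ratr q3) n - clip (ratr q3)| <= e / 4 by near: n; exact: GH.
have : `|G (ratr q4) n - clip (ratr q4)| <= e / 4 by near: n; exact: GH.
rewrite !ler_norml => /andP[? ?] /andP[? ?] /andP[? ?] /andP[? ?].
by apply/andP; split; lra.
Unshelve. all: by end_near.
Qed.
End interval_frequency.

Section uniform_sampling.
Context (R : realType) d1 (T1 : measurableType d1).
Context d (Omega : measurableType d) (PP : probability Omega R).
Variables (S : {RV PP >-> T1}) (X : nat -> {RV PP >-> R}).
Hypothesis X_unif : forall l (B : set R), measurable B ->
  PP (X l @^-1` B) = uniform_prob (@ltr01 R) B.
Hypothesis indep : mutually_independent S X.

(** The null set does not depend on the interval, which may therefore be chosen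
    as a function of S. *)
Lemma ae_interval_frequency : {ae PP, forall w, forall a b : R, a <= b ->
  `]a, b[%classic `<=` `[0, 1]%classic ->
  interval_frequency `]a, b[%classic (fun l => X l w) n @[n --> \oo] --> b - a}.
Proof.
have X_id l (B : set R) : measurable B -> PP (X l @^-1` B) = PP (X 0%N @^-1` B).
  by move=> mB; rewrite !X_unif.
have H (j : nat) : {ae PP, forall w, sample_mean S X
    (below (ratr (odflt 0 (unpickle j : option rat)))) n w @[n --> \oo] --> (0 : R)}.
  apply: cvg_sample_mean0 => //; first exact: measurable_below.
    apply: (@integrable_le_cst _ _ _ _ _ 1).
      by apply: measurable_observe; exact: measurable_below.
    by move=> w; exact: normr_below_le1.
  move=> eta eta0.
  (* with delta = eta / 2 the second term 1 / (m * delta) must be at most eta / 2 *)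
  have [m] : exists m : nat, (2 / eta) ^+ 2 < m%:R.
    by exists (Num.truncn ((2 / eta) ^+ 2)).+1; exact: truncnS_gt.
  move=> mgt.
  have m0 : (0 < m)%N.
    by rewrite -(ltr_nat R) (le_lt_trans _ mgt)// exprn_ge0// divr_ge0// ltW.
  exists m => //; apply: le_trans (integral_sample_mean_below X_unif indep _ m0 _) _.
    exact: (divr_gt0 eta0 (ltr0n R 2)).
  rewrite lee_fin -lerBrDl -[X in X <= _]mul1r ler_pdivrMr ?mulr_gt0 ?divr_gt0 ?ltr0n//.
  by move: mgt; rewrite expr_div_n ltr_pdivrMr ?exprn_gt0//; lra.
have := ae_foralln H; apply: filterS => w Hw a b; apply: cvg_interval_frequency => q.
by have := Hw (pickle q); rewrite pickleK.
Qed.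

(** Fubini's theorem for the independent pair of S and the first observation. *)
Lemma integral_first_observation (h : T1 * R -> \bar R) :
  measurable_fun setT h -> (forall p, 0 <= h p)%E ->
  (\int[PP]_w h (S w, X 0%N w) =
   \int[PP]_w \int[distribution PP (X 0%N)]_y h (S w, y))%E.
Proof.
move=> mh h0.
pose phi w := (S w, X 0%N w).
have mphi : measurable_fun setT phi by apply: measurable_fun_pair; exact: measurable_funPT.
pose phi' : {mfun Omega >-> (T1 * R)%type} := HB.pack phi (isMeasurableFun.Build _ _ _ _ phi mphi).
transitivity (\int[pushforward PP phi']_p h p)%E.
  by rewrite ge0_integral_pushforward// ?preimage_setT.
transitivity (\int[(distribution PP S \x distribution PP (X 0%N))%E]_p h p)%E.
  apply: (eq_measure_integral (distribution PP S \x distribution PP (X 0%N))%E) => A mA _.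
  apply/esym; apply: product_measure_unique => // B C mB mC.
  have := @indep B (fun=> C) 1%N mB (fun=> mC).
  rewrite big_ord1 => <-; congr (PP _).
  apply/seteqP; split => w /=; first by move=> [Bw Cw]; split => // i /=; case: i.
  by move=> [Bw Cw]; split => //; exact: (Cw 0%N).
rewrite fubini_tonelli1// ge0_integral_distribution//.
  exact: measurable_fun_fubini_tonelli_F.
by move=> y; apply: integral_ge0.
Qed.
End uniform_sampling.

(** * Masses and frequencies of species *)

Lemma term_le_nneseries1 (R : realType) (u : nat -> R) i : (forall i, 0 <= u i) ->
  (\sum_(0 <= i <oo) (u i)%:E = 1)%E -> u i <= 1.
Proof.
move=> u0 u1; rewrite -lee_fin -u1 (@nneseriesD1 _ (fun i => (u i)%:E) i)//; last first.
  by move=> k _; rewrite lee_fin.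
by rewrite leeDl//; apply: nneseries_ge0 => k _ _; rewrite lee_fin.
Qed.

Section mass_partition_facts.
Context (R : realType).
Implicit Type s : massPartition R.

Lemma mass_le1 s i : s i <= 1.
Proof. by apply: term_le_nneseries1 (mass_sum1 s); exact: mass_ge0. Qed.

Lemma Nln_mass_ge0 s i : 0 <= - ln (s i).
Proof. by rewrite oppr_ge0 ln_le0// mass_le1. Qed.

Lemma measurable_mass i : measurable_fun setT (fun s : massPartition R => s i).
Proof.
by move=> _ B mB; rewrite setTI; apply: sub_sigma_algebra; exists i, B.
Qed.

Lemma shannonE (s : nat -> R) : (forall i, 0 <= s i <= 1) ->
  (shannon s = \sum_(0 <= i <oo) (s i * - ln (s i))%:E)%E.
Proof.
move=> s01; rewrite /shannon -limeN; last first.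
  apply: is_cvg_npeseries => i _ _; have /andP[s0 s1] := s01 i.
  by rewrite lee_fin mulr_ge0_le0// ln_le0.
congr (limn _); apply/funext => n; rewrite !sumEFin -EFinN -sumrN.
by congr EFin; apply: eq_bigr => i _; rewrite mulrN.
Qed.

Lemma mass_itv s i : 0 <= s i <= 1.
Proof. by rewrite mass_ge0 mass_le1. Qed.

Lemma shannon_ge0 (s : nat -> R) : (forall i, 0 <= s i <= 1) -> (0 <= shannon s)%E.
Proof.
move=> s01; rewrite shannonE//; apply: nneseries_ge0 => i _ _.
have /andP[s0 s1] := s01 i.
by rewrite lee_fin mulr_ge0// oppr_ge0 ln_le0.
Qed.

Lemma measurable_mass_nneseries (g : nat -> R -> R) :
  (forall i, measurable_fun setT (g i)) ->
  (forall (s : massPartition R) i, 0 <= g i (s i)) ->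
  measurable_fun setT (fun s : massPartition R => \sum_(0 <= i <oo) (g i (s i))%:E)%E.
Proof.
move=> mg g0; apply: (@ge0_emeasurable_sum _ _ _ _ _ xpredT) => [i s _ _|i _].
  by rewrite lee_fin g0.
by apply/measurable_EFinP; apply: (measurableT_comp (mg i)); exact: measurable_mass.
Qed.

Lemma measurable_shannon :
  measurable_fun setT (fun s : massPartition R => shannon s).
Proof.
under eq_fun => s do rewrite (shannonE (mass_itv s)).
apply: (@measurable_mass_nneseries (fun _ x => x * - ln x)).
  by move=> _; apply: measurable_funM => //; apply: measurableT_comp => //; exact: measurable_ln.
by move=> s i; rewrite mulr_ge0// ?mass_ge0// Nln_mass_ge0.
Qed.

Lemma measurable_gini kappa :
  measurable_fun setT (fun s : massPartition R => gini kappa s).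
Proof.
apply: emeasurable_funB => //.
apply: (@measurable_mass_nneseries (fun _ x => x `^ (kappa + 1))).
  by move=> _; exact: measurable_powR.
by move=> s i; exact: powR_ge0.
Qed.

Lemma nneseries_if_tail_cvg0 (t : nat -> \bar R) : (forall i, 0 <= t i)%E ->
  (\sum_(0 <= i <oo) t i < +oo)%E ->
  (\sum_(0 <= i <oo) (if (M <= i)%N then t i else 0) @[M --> \oo] --> 0)%E.
Proof.
move=> t0 toy; have := nneseries_tail_cvg toy (fun i _ => t0 i).
apply: cvg_trans; apply: near_eq_cvg; near=> M.
by rewrite [LHS]eseries_cond/= [LHS]eseries_mkcond.
Unshelve. all: by end_near.
Qed.

End mass_partition_facts.

Section species_sampling.
Context (R : realType).
Variables (a : massPartition R -> nat -> R) (ha : interval_arrangement a).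
Context d (Omega : measurableType d) (PP : probability Omega R).
Variables (S : {RV PP >-> massPartition R}) (X : nat -> {RV PP >-> R}).
Hypothesis X_unif : forall l (B : set R), measurable B ->
  PP (X l @^-1` B) = uniform_prob (@ltr01 R) B.
Hypothesis indep : mutually_independent S X.

Let X_id l (B : set R) : measurable B -> PP (X l @^-1` B) = PP (X 0%N @^-1` B).
Proof. by move=> mB; rewrite !X_unif. Qed.

Definition in_species (i : nat) : set (massPartition R * R) :=
  [set p | species_interval a p.1 i p.2].

Lemma in_species_uniq p i j : in_species i p -> in_species j p -> i = j.
Proof.
move=> ip jp; apply: (@arrangement_disjoint _ _ ha p.1 i j) => //.
by exists p.2.
Qed.

Lemma measurable_in_species i : measurable (in_species i).
Proof.
have m1 : measurable_fun setT (fun p : massPartition R * R => p.2 - a p.1 i).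
  apply: measurable_funB; first exact: measurable_snd.
  by apply: (measurableT_comp (arrangement_measurable ha i)); exact: measurable_fst.
have m2 : measurable_fun setT (fun p : massPartition R * R => a p.1 i + p.1 i - p.2).
  apply: measurable_funB; last exact: measurable_snd.
  apply: measurable_funD.
    by apply: (measurableT_comp (arrangement_measurable ha i)); exact: measurable_fst.
  by apply: (measurableT_comp (measurable_mass i)); exact: measurable_fst.
rewrite (_ : in_species i = [set p | 0 < p.2 - a p.1 i] `&`
    [set p | 0 < a p.1 i + p.1 i - p.2]).
  by apply: measurableI; exact: measurable_set_gt.
apply/seteqP; split => p; rewrite /in_species /species_interval /= in_itv/= !subr_gt0.
  by move=> /andP[].
by move=> [-> ->].
Qed.

Lemma ae_species_frequency : {ae PP, forall w i,
  interval_frequency (species_interval a (S w) i) (fun l => X l w) n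
    @[n --> \oo] --> S w i}.
Proof.
have := ae_interval_frequency X_unif indep; apply: filterS => w H i.
have := H (a (S w) i) (a (S w) i + S w i).
rewrite addrAC subrr add0r; apply; first by rewrite lerDl mass_ge0.
exact: (arrangement_sub01 ha).
Qed.

(** Given S, the first observation falls in the i-th interval with probability
    its length. *)
Lemma integral_in_species (g : massPartition R -> R) i :
  measurable_fun setT g -> (forall s, 0 <= g s) ->
  (\int[PP]_w (\1_(in_species i) (S w, X 0%N w) * g (S w))%:E =
   \int[PP]_w (S w i * g (S w))%:E)%E.
Proof.
move=> mg g0.
pose h p : \bar R := (\1_(in_species i) p * g p.1)%:E.
rewrite (integral_first_observation indep (h := h)); last 2 first.
- apply/measurable_EFinP; apply: measurable_funM.
    by apply: measurable_indic; exact: measurable_in_species.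
  by apply: (measurableT_comp mg); exact: measurable_fst.
- by move=> p; rewrite lee_fin mulr_ge0.
apply: eq_integral => w _; rewrite /h/=.
have mI : measurable (species_interval a (S w) i) by exact: measurable_itv.
under eq_integral => y _.
  rewrite (_ : \1_(in_species i) (S w, y) = \1_(species_interval a (S w) i) y); last first.
    by rewrite !indicE; congr (_%:R); apply/idP/idP; rewrite !inE.
  rewrite mulrC EFinM; over.
rewrite ge0_integralZl//; last 2 first.
- by apply/measurable_EFinP; exact: measurable_indic.
- by rewrite lee_fin.
rewrite integral_indic// setIT mulrC EFinM; congr (_ * _)%E.
rewrite [LHS]X_unif// uniform_prob_subitv.
- by rewrite addrAC subrr add0r.
- by rewrite lerDl mass_ge0.
- exact: (arrangement_sub01 ha).
Qed.

(** The lengths of the disjoint intervals add up to 1, so that they cover [0, 1]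
    up to a null set. *)
Lemma ae_in_some_species : {ae PP, forall w l, exists i, in_species i (S w, X l w)}.
Proof.
apply: ae_foralln => l.
pose U := \bigcup_i in_species i.
have mU : measurable U by apply: bigcupT_measurable => i; exact: measurable_in_species.
pose V k := [set w | U (S w, X k w)].
have mV k : measurable (V k).
  have : measurable_fun setT (fun w => (S w, X k w)).
    by apply: measurable_fun_pair; exact: measurable_funPT.
  by move=> /(_ measurableT _ mU); rewrite setTI.
have VE : PP (V l) = PP (V 0%N).
  have := @integral_observe_symmetric _ _ _ _ _ PP S X X_id indep \1_U l.+1 setT l
    (measurable_indic mU) _ (ltnSn l).
  have e k : (\int[PP]_w (observe S X \1_U k w)%:E = PP (V k))%E.
    transitivity (PP (V k `&` setT)); last by rewrite setIT.
    by rewrite -integral_indic.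
  by rewrite !e; apply; exists setT; split.
exists (~` V l); split; first exact: measurableC.
  apply: (etrans (probability_setC PP (mV l))); rewrite VE.
  suff -> : PP (V 0%N) = 1%E by rewrite subee.
  pose W i := [set w | in_species i (S w, X 0%N w)].
  have mW i : measurable (W i).
    have : measurable_fun setT (fun w => (S w, X 0%N w)).
      by apply: measurable_fun_pair; exact: measurable_funPT.
    by move=> /(_ measurableT _ (measurable_in_species i)); rewrite setTI.
  have -> : V 0%N = \bigcup_i W i by apply/seteqP; split => w [i _ iw]; exists i.
  rewrite measure_bigcup//; last first.
    by move=> i j _ _ [w [iw jw]]; exact: (in_species_uniq iw jw).
  rewrite (eq_eseriesl (Q := xpredT)); last by move=> i; rewrite in_setT.
  rewrite -[RHS](integral_cst_probability PP 1%E).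
  under [RHS]eq_integral => w _ do rewrite -(mass_sum1 (S w)).
  rewrite integral_nneseries//; last 2 first.
  - by move=> i; apply/measurable_EFinP; apply: (measurableT_comp (measurable_mass i)).
  - by move=> i w _; rewrite lee_fin mass_ge0.
  apply: eq_eseriesr => i _.
  have := @integral_in_species (fun=> 1) i (measurable_cst _) (fun=> ler01).
  under [in X in _ = X -> _]eq_integral do rewrite mulr1.
  move=> <-; transitivity (PP (W i `&` setT)); first by rewrite setIT.
  rewrite -integral_indic//; apply: eq_integral => w _.
  by rewrite mulr1 !indicE; congr (_%:R%:E); apply/idP/idP; rewrite !inE.
move=> w /= nw Vw; apply: nw; by case: Vw => i _; exists i.
Qed.
End species_sampling.

(** * The tail of the surprise *)

Section surprise.
Context (R : realType).
Variables (a : massPartition R -> nat -> R) (ha : interval_arrangement a).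

Definition surprise_term (M : nat) (p : massPartition R * R) (i : nat) : R :=
  if (M <= i)%N then \1_(in_species a i) p * - ln (p.1 i) else 0.

Lemma surprise_term_ge0 M p i : 0 <= surprise_term M p i.
Proof.
rewrite /surprise_term; case: ifP => // _.
by rewrite mulr_ge0// Nln_mass_ge0.
Qed.

(** The surprise - ln s(i) of observing species i, kept for M <= i only.  At most
    one term of the series is nonzero; the series makes measurability and
    integration termwise. *)
Definition surprise (M : nat) (p : massPartition R * R) : R :=
  fine (\sum_(0 <= i <oo) (surprise_term M p i)%:E)%E.

Lemma surprise_series M p i : in_species a i p ->
  (\sum_(0 <= i <oo) (surprise_term M p i)%:E =
   (if (M <= i)%N then - ln (p.1 i) else 0)%:E)%E.
Proof.
move=> ip; rewrite (@nneseriesD1 _ (fun i => (surprise_term M p i)%:E) i)//; last first.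
  by move=> k _; rewrite lee_fin surprise_term_ge0.
rewrite eseries0 ?adde0.
  by rewrite /surprise_term indicE mem_set//=; case: ifP; rewrite ?mul1r.
move=> k _ /= ki; rewrite /surprise_term indicE memNset ?mul0r; first by case: ifP.
by move=> kp; move: ki; rewrite (in_species_uniq ha kp ip) eqxx.
Qed.

Lemma surpriseE M p i : in_species a i p ->
  surprise M p = if (M <= i)%N then - ln (p.1 i) else 0.
Proof. by move=> ip; rewrite /surprise (surprise_series M ip). Qed.

Lemma EFin_surprise M p :
  ((surprise M p)%:E = \sum_(0 <= i <oo) (surprise_term M p i)%:E)%E.
Proof.
have [[i ip]|np] := pselect (exists i, in_species a i p).
  by rewrite /surprise (surprise_series M ip).
rewrite /surprise eseries0// => i _ _.
rewrite /surprise_term indicE memNset ?mul0r; first by case: ifP.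
by move=> ip; apply: np; exists i.
Qed.

Lemma surprise_ge0 M p : 0 <= surprise M p.
Proof.
rewrite -lee_fin EFin_surprise; apply: nneseries_ge0 => i _ _.
by rewrite lee_fin surprise_term_ge0.
Qed.

Lemma measurable_surprise_term M i : measurable_fun setT (surprise_term M ^~ i).
Proof.
rewrite /surprise_term; case: (M <= i)%N => //.
apply: measurable_funM; first by apply: measurable_indic; exact: measurable_in_species.
apply: measurableT_comp => //; apply: (measurableT_comp (@measurable_ln _)).
by apply: (measurableT_comp (measurable_mass i)); exact: measurable_fst.
Qed.

Lemma measurable_surprise M : measurable_fun setT (surprise M).
Proof.
apply/measurable_EFinP.
rewrite (_ : _ \o _ = fun p => \sum_(0 <= i <oo) (surprise_term M p i)%:E)%E; last first.
  by apply/funext => p; exact: EFin_surprise.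
apply: (@ge0_emeasurable_sum _ _ _ _ _ xpredT) => [i p _ _|i _].
  by rewrite lee_fin surprise_term_ge0.
by apply/measurable_EFinP; exact: measurable_surprise_term.
Qed.

Context d (Omega : measurableType d) (PP : probability Omega R).
Variables (S : {RV PP >-> massPartition R}) (X : nat -> {RV PP >-> R}).
Hypothesis X_unif : forall l (B : set R), measurable B ->
  PP (X l @^-1` B) = uniform_prob (@ltr01 R) B.
Hypothesis indep : mutually_independent S X.
Hypothesis entropy_fin : (\int[PP]_w shannon (S w) < +oo)%E.

Let X_id l (B : set R) : measurable B -> PP (X l @^-1` B) = PP (X 0%N @^-1` B).
Proof. by move=> mB; rewrite !X_unif. Qed.

Let entropy_term i : \bar R := (\int[PP]_w (S w i * - ln (S w i))%:E)%E.

Let entropy_term_ge0 i : (0 <= entropy_term i)%E.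
Proof.
by apply: integral_ge0 => w _; rewrite lee_fin mulr_ge0 ?mass_ge0// Nln_mass_ge0.
Qed.

Let entropy_term_lty : (\sum_(0 <= i <oo) entropy_term i < +oo)%E.
Proof.
rewrite -integral_nneseries//.
- by under eq_integral => w _ do rewrite -(shannonE (mass_itv (S w))).
- move=> i; apply/measurable_EFinP.
  have m1 : measurable_fun setT (fun w => S w i) by apply: (measurableT_comp (measurable_mass i)).
  apply: measurable_funM => //; apply: measurableT_comp => //.
  exact: (measurableT_comp (@measurable_ln _) m1).
- by move=> i w _; rewrite lee_fin mulr_ge0 ?mass_ge0// Nln_mass_ge0.
Qed.

Lemma integral_surprise M : (\int[PP]_w (surprise M (S w, X 0%N w))%:E =
  \sum_(0 <= i <oo) (if (M <= i)%N then entropy_term i else 0))%E.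
Proof.
under eq_integral => w _ do rewrite EFin_surprise.
have mSX : measurable_fun setT (fun w => (S w, X 0%N w)).
  by apply: measurable_fun_pair; exact: measurable_funPT.
rewrite integral_nneseries//; last 2 first.
- move=> i; apply/measurable_EFinP.
  exact: (measurableT_comp (measurable_surprise_term M i) mSX).
- by move=> i w _; rewrite lee_fin surprise_term_ge0.
apply: eq_eseriesr => i _; rewrite /surprise_term; case: ifP => Mi; last by rewrite integral0.
rewrite (integral_in_species ha X_unif indep (g := fun s => - ln (s i)))//.
- apply: measurableT_comp => //; apply: (measurableT_comp (@measurable_ln _)).
  exact: measurable_mass.
- by move=> s; exact: Nln_mass_ge0.
Qed.

(** All the means are bounded at once, by the maximal inequality, in terms of the
    expectation of a single term, which is a tail of the series of the mean
    entropy. *)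
Lemma ae_mean_surprise : {ae PP, forall w (e : R), 0 < e ->
  exists M, forall n, sample_mean S X (surprise M) n.+1 w <= e}.
Proof.
have int_surprise M : PP.-integrable setT (EFin \o observe S X (surprise M) 0).
  apply/integrableP; split.
    by apply/measurable_EFinP; apply: measurable_observe; exact: measurable_surprise.
  under eq_integral => w _ do rewrite /= ger0_norm ?surprise_ge0//.
  rewrite integral_surprise; apply: le_lt_trans entropy_term_lty.
  by apply: lee_nneseries => [i _ _|i _]; case: ifP.
have msm M n : measurable_fun setT (sample_mean S X (surprise M) n).
  by apply: measurable_sample_mean; exact: measurable_surprise.
pose A (e : R) M := \bigcup_k [set w | e < sample_mean S X (surprise M) (1 + k) w].
have mA e M : measurable (A e M).
  by apply: bigcupT_measurable => k; exact: measurable_set_gt.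
have sA (e e' : R) M : e <= e' -> A e' M `<=` A e M.
  by move=> ee' w [k _ /= lt]; exists k => //=; exact: le_lt_trans lt.
have smallA (e eta : R) : 0 < e -> 0 < eta -> exists M, (PP (A e M) <= eta%:E)%E.
  move=> e0 eta0.
  have : (\sum_(0 <= i <oo) (if (M <= i)%N then entropy_term i else 0) @[M --> \oo] --> 0)%E.
    exact: nneseries_if_tail_cvg0.
  have ee0 : (0 < (e * eta)%:E)%E by rewrite lte_fin mulr_gt0.
  move=> /(_ _ (open_ereal_lt' ee0))[M _ /(_ M (leqnn M)) /= HM]; exists M.
  rewrite -(@lee_pmul2l _ e%:E)// ?lte_fin// -EFinM.
  apply: le_trans (maximal_sample_mean_gt X_id indep (measurable_surprise M)
    (int_surprise M) (ltW e0) (ltnSn 0)) _.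
  rewrite (eq_integral (fun w => (surprise M (S w, X 0%N w))%:E)).
    by rewrite integral_surprise ltW.
  move=> w _; rewrite /sample_mean big_ord1 divr1 gee0_abs// lee_fin.
  exact: surprise_ge0.
have := ae_exists_notin mA sA smallA; apply: filterS => w H e e0.
have [M nA] := H e e0; exists M => n; rewrite leNgt; apply/negP => lt.
by apply: nA; exists n.
Qed.
End surprise.

(** * Limits of sums over species *)

Section limit_of_sums.
Context (R : realType).

Lemma nneseries_partial_sum (u : nat -> R) (L e : R) : (forall i, 0 <= u i) ->
  (\sum_(0 <= i <oo) (u i)%:E = L%:E)%E -> 0 < e ->
  exists M0, forall M, (M0 <= M)%N -> L - e <= \sum_(i < M) u i <= L.
Proof.
move=> u0 uL e0.
have uc : (\sum_(i < M) u i)%:E @[M --> \oo] --> L%:E.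
  have cu : cvgn (fun n => \sum_(0 <= i < n) (u i)%:E)%E.
    by apply: is_cvg_nneseries => i _ _; rewrite lee_fin.
  rewrite -uL; apply: cvg_trans cu; apply: near_eq_cvg; apply: nearW => n.
  by rewrite sumEFin big_mkord.
have uc' : \sum_(i < M) u i @[M --> \oo] --> L by apply: fine_cvg uc.
have /cvgrPdist_le /(_ e e0) [M0 _ H] := uc'.
exists M0 => M MM; apply/andP; split.
  by have := H M MM; rewrite /= ler_norml => /andP[_]; lra.
rewrite -lee_fin -uL -sumEFin -(big_mkord xpredT (fun i => (u i)%:E)).
by apply: nneseries_lim_ge => i _ _; rewrite lee_fin.
Qed.

Lemma cvg_sum_ord (f : nat -> nat -> R) (l : nat -> R) M :
  (forall i, f i n @[n --> \oo] --> l i) ->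
  \sum_(i < M) f i n @[n --> \oo] --> \sum_(i < M) l i.
Proof.
move=> fl; elim: M => [|M IH].
  by rewrite big_ord0; under eq_fun do rewrite big_ord0; exact: cvg_cst.
rewrite big_ord_recr/=; under eq_fun do rewrite big_ord_recr/=.
exact: cvgD.
Qed.

Variables (s : nat -> R) (p : nat -> nat -> R) (supp : nat -> nat).
Hypothesis s_ge0 : forall i, 0 <= s i.
Hypothesis s_sum1 : (\sum_(0 <= i <oo) (s i)%:E = 1)%E.
Hypothesis p_ge0 : forall i n, 0 <= p i n.
Hypothesis p_cvg : forall i, p i n @[n --> \oo] --> s i.
Hypothesis p_sum1 : forall n K, (0 < n)%N -> (supp n <= K)%N -> \sum_(i < K) p i n = 1.

Let s_le1 i : s i <= 1. Proof. exact: term_le_nneseries1. Qed.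

Let p_le1 i n : (0 < n)%N -> p i n <= 1.
Proof.
move=> n0; rewrite -(p_sum1 n0 (leq_maxl (supp n) i.+1)).
have h : (i < maxn (supp n) i.+1)%N by rewrite leq_max ltnSn orbT.
by rewrite (bigD1 (Ordinal h))//= lerDl sumr_ge0.
Qed.

(** The first M terms converge and already carry almost all of the mass, in the
    limit and hence eventually along the sequence; as psi is below the identity,
    the other terms contribute little to either sum. *)
Lemma cvg_sum_dominated (psi : R -> R) (T : nat -> R) :
  (forall x, 0 <= x <= 1 -> 0 <= psi x <= x) ->
  (forall i, psi (p i n) @[n --> \oo] --> psi (s i)) ->
  (forall n K, (supp n <= K)%N -> T n = \sum_(i < K) psi (p i n)) ->
  (T n)%:E @[n --> \oo] --> (\sum_(0 <= i <oo) (psi (s i))%:E)%E.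
Proof.
move=> psi_le psi_cvg TE.
have ps i : 0 <= psi (s i) <= s i by apply: psi_le; rewrite s_ge0 s_le1.
have pp i n : (0 < n)%N -> 0 <= psi (p i n) <= p i n.
  by move=> n0; apply: psi_le; rewrite p_ge0 p_le1.
have ps0 i : 0 <= psi (s i) by case/andP: (ps i).
have [L LE] : exists L : R, (\sum_(0 <= i <oo) (psi (s i))%:E = L%:E)%E.
  exists (fine (\sum_(0 <= i <oo) (psi (s i))%:E)%E); rewrite fineK//.
  rewrite ge0_fin_numE; last by apply: nneseries_ge0 => i _ _; rewrite lee_fin.
  apply: (@le_lt_trans _ _ 1%E); last by rewrite ltry.
  rewrite -s_sum1; apply: lee_nneseries => [i _ _|i _]; rewrite lee_fin//.
  by case/andP: (ps i).
rewrite LE; apply: cvg_EFin; first exact: nearW.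
apply/cvgrPdist_le => e e0; rewrite /=.
have e4 : 0 < e / 4 by rewrite divr_gt0.
have [M1 H1] := nneseries_partial_sum ps0 LE e4.
have [M2 H2] := nneseries_partial_sum s_ge0 s_sum1 e4.
pose M := maxn M1 M2.
have /andP[a1 a2] := H1 M (leq_maxl _ _).
have /andP[b1 b2] := H2 M (leq_maxr _ _).
have c1 : \sum_(i < M) psi (p i n) @[n --> \oo] --> \sum_(i < M) psi (s i).
  exact: (@cvg_sum_ord (fun i n => psi (p i n)) (fun i => psi (s i)) M psi_cvg).
have c2 : \sum_(i < M) p i n @[n --> \oo] --> \sum_(i < M) s i.
  exact: (@cvg_sum_ord _ _ M p_cvg).
near=> n.
have n0 : (0 < n)%N by near: n; exists 1%N.
have d1 : `|\sum_(i < M) psi (s i) - \sum_(i < M) psi (p i n)| <= e / 4.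
  by near: n; have /cvgrPdist_le := c1; exact.
have d2 : `|\sum_(i < M) s i - \sum_(i < M) p i n| <= e / 4.
  by near: n; have /cvgrPdist_le := c2; exact.
pose K := maxn (supp n) M.
have split_sum (f : nat -> R) : \sum_(i < K) f i = \sum_(i < M) f i + \sum_(M <= i < K) f i.
  by rewrite -!(big_mkord xpredT) -big_cat_nat//= leq_maxr.
have TK := TE n K (leq_maxl _ _).
rewrite TK (split_sum (fun i => psi (p i n))).
have := p_sum1 n0 (leq_maxl (supp n) M); rewrite -/K (split_sum (p ^~ n)) => pK.
have t0 : 0 <= \sum_(M <= i < K) psi (p i n).
  by apply: sumr_ge0 => i _; case/andP: (pp i n n0).
have t1 : \sum_(M <= i < K) psi (p i n) <= \sum_(M <= i < K) p i n.
  by apply: ler_sum => i _; case/andP: (pp i n n0).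
move: d1 d2; rewrite !ler_norml => /andP[d1 d1'] /andP[d2 d2'].
by apply/andP; split; lra.
Unshelve. all: by end_near.
Qed.

Hypothesis p_eq0 : forall i n, s i = 0 -> p i n = 0.
Hypothesis surprise_tail : forall e, 0 < e -> exists M, forall n K, (supp n <= K)%N ->
  (0 < n)%N -> \sum_(M <= i < K) p i n * - ln (s i) <= e.

(** This is ln t <= t - 1 at t = y / x. *)
Lemma gibbs (x y : R) : 0 <= x -> 0 <= y -> (y = 0 -> x = 0) ->
  x * - ln x <= x * - ln y + (y - x).
Proof.
move=> x0 y0 yx; have [->|xn0] := eqVneq x 0; first by rewrite !mul0r add0r subr0.
have xp : 0 < x by rewrite lt_neqAle eq_sym xn0.
have yp : 0 < y.
  by rewrite lt_neqAle eq_sym y0 andbT; apply/eqP => /yx /eqP; rewrite (negbTE xn0).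
have h := @le_ln1Dx R (y / x - 1).
have : ln (y / x) <= y / x - 1.
  rewrite -[X in ln X <= _](addrNK 1) [X in ln X](addrC _ 1); apply: h.
  by rewrite ltrBrDl subrr divr_gt0.
rewrite ln_div ?posrE// -(ler_pM2l xp) mulrBr [leRHS]mulrBr mulrCA divff// !mulr1.
lra.
Qed.

(** The lower bound keeps finitely many nonnegative terms.  The upper bound is
    Gibbs' inequality, whose error terms sum to at most 0, followed by the control
    of the tail. *)
Lemma cvg_entropy_sum (T : nat -> R) :
  (\sum_(0 <= i <oo) (s i * - ln (s i))%:E < +oo)%E ->
  (forall n K, (supp n <= K)%N -> T n = \sum_(i < K) p i n * - ln (p i n)) ->
  (T n)%:E @[n --> \oo] --> (\sum_(0 <= i <oo) (s i * - ln (s i))%:E)%E.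
Proof.
move=> Hfin TE.
have s0 i : 0 <= s i * - ln (s i) by rewrite mulr_ge0// oppr_ge0 ln_le0.
have pn0 i n : (0 < n)%N -> 0 <= p i n * - ln (p i n).
  by move=> n0; rewrite mulr_ge0// oppr_ge0 ln_le0// p_le1.
have [L LE] : exists L : R, (\sum_(0 <= i <oo) (s i * - ln (s i))%:E = L%:E)%E.
  exists (fine (\sum_(0 <= i <oo) (s i * - ln (s i))%:E)%E); rewrite fineK//.
  by rewrite ge0_fin_numE//; apply: nneseries_ge0 => i _ _; rewrite lee_fin.
rewrite LE; apply: cvg_EFin; first exact: nearW.
apply/cvgrPdist_le => e e0; rewrite /=.
have e2 : 0 < e / 2 by rewrite divr_gt0.
have [M1 H1] := nneseries_partial_sum s0 LE e2.
have [M2 H2] := surprise_tail e2.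
have /andP[a1 _] := H1 M1 (leqnn _).
have eta_cvg i : p i n * - ln (p i n) @[n --> \oo] --> s i * - ln (s i).
  have [s_eq0|sn0] := eqVneq (s i) 0.
    rewrite s_eq0 mul0r (_ : (fun n => _) = fun=> 0); first exact: cvg_cst.
    by apply/funext => n; rewrite p_eq0// mul0r.
  apply: cvgM; first exact: p_cvg.
  apply: cvgN; apply: continuous_cvg; last exact: p_cvg.
  by apply: continuous_ln; rewrite lt_neqAle eq_sym sn0 s_ge0.
have c1 : \sum_(i < M1) p i n * - ln (p i n) @[n --> \oo] --> \sum_(i < M1) s i * - ln (s i).
  exact: (@cvg_sum_ord (fun i n => p i n * - ln (p i n)) (fun i => s i * - ln (s i)) M1 eta_cvg).
have c2 : \sum_(i < M2) p i n * - ln (s i) @[n --> \oo] --> \sum_(i < M2) s i * - ln (s i).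
  apply: (@cvg_sum_ord (fun i n => p i n * - ln (s i)) (fun i => s i * - ln (s i))) => i.
  by apply: cvgM; [exact: p_cvg|exact: cvg_cst].
have b2 : \sum_(i < M2) s i * - ln (s i) <= L.
  have : (L%:E >= (\sum_(i < M2) s i * - ln (s i))%:E)%E.
    rewrite -LE -sumEFin -(big_mkord xpredT (fun i => (s i * - ln (s i))%:E)).
    by apply: nneseries_lim_ge => i _ _; rewrite lee_fin.
  by rewrite lee_fin.
near=> n.
have n0 : (0 < n)%N by near: n; exists 1%N.
have d1 : `|\sum_(i < M1) s i * - ln (s i) - \sum_(i < M1) p i n * - ln (p i n)| <= e / 2.
  by near: n; have /cvgrPdist_le := c1; exact.
have d2 : `|\sum_(i < M2) s i * - ln (s i) - \sum_(i < M2) p i n * - ln (s i)| <= e / 2.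
  by near: n; have /cvgrPdist_le := c2; exact.
move: d1 d2; rewrite !ler_norml => /andP[d1 d1'] /andP[d2 d2'].
pose K := maxn (supp n) (maxn M1 M2).
have K1 : (M1 <= K)%N by rewrite /K !leq_max leqnn orbT.
have K2 : (M2 <= K)%N by rewrite /K !leq_max leqnn !orbT.
have split_sum (f : nat -> R) M : (M <= K)%N ->
    \sum_(i < K) f i = \sum_(i < M) f i + \sum_(M <= i < K) f i.
  by move=> MK; rewrite -!(big_mkord xpredT) -big_cat_nat.
have TK := TE n K (leq_maxl _ _).
have pK := p_sum1 n0 (leq_maxl (supp n) (maxn M1 M2)).
have sK : \sum_(i < K) s i <= 1.
  rewrite -lee_fin -s_sum1 -sumEFin -(big_mkord xpredT (fun i => (s i)%:E)).
  by apply: nneseries_lim_ge => i _ _; rewrite lee_fin.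
have lower : \sum_(i < M1) p i n * - ln (p i n) <= T n.
  rewrite TK (split_sum (fun i => p i n * - ln (p i n)) M1)// lerDl.
  by apply: sumr_ge0 => i _; exact: pn0.
have upper : T n <= \sum_(i < K) p i n * - ln (s i) + (\sum_(i < K) s i - \sum_(i < K) p i n).
  rewrite TK -sumrB -big_split/=; apply: ler_sum => i _.
  by apply: gibbs => // /p_eq0.
have := H2 n K (leq_maxl _ _) n0.
move: upper; rewrite (split_sum (fun i => p i n * - ln (s i)) M2)// pK => upper tail.
by apply/andP; split; lra.
Unshelve. all: by end_near.
Qed.

End limit_of_sums.

(** * Counts of the classes of a relation *)

(** The discoverers and the species counts depend on the sample only through the
    relation of belonging to the same species. *)
Definition class_firsts (e : rel nat) (n : nat) : seq nat :=
  [seq l <- iota 0 n | ~~ has (e l) (iota 0 l)].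

Definition class_counts (e : rel nat) (n : nat) : seq nat :=
  [seq count (e l) (iota 0 n) | l <- class_firsts e n].

Lemma eq_class_counts (e e' : rel nat) n :
  (forall l m, (l < n)%N -> (m < n)%N -> e l m = e' l m) ->
  class_counts e n = class_counts e' n.
Proof.
move=> ee; rewrite /class_counts.
have -> : class_firsts e n = class_firsts e' n.
  apply: eq_in_filter => l; rewrite mem_iota/= => ln; congr (~~ _).
  apply: eq_in_has => m; rewrite mem_iota/= => ml.
  by apply: ee => //; exact: ltn_trans ln.
apply/eq_in_map => l; rewrite mem_filter mem_iota/= => /andP[_ ln].
by apply: eq_in_count => m; rewrite mem_iota/= => mn; exact: ee.
Qed.

Section labelling.
Variables (e : rel nat) (lab : nat -> nat).
Hypothesis elab : forall l m, e l m = (lab l == lab m).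

Definition label_word (n : nat) := [seq lab l | l <- iota 0 n].

Lemma class_firsts_uniq n : uniq [seq lab l | l <- class_firsts e n].
Proof.
rewrite map_inj_in_uniq ?filter_uniq ?iota_uniq// => l m.
rewrite !mem_filter !mem_iota/= => /andP[fl _] /andP[fm _] lm.
case: (ltngtP l m) => // [ltlm|ltml].
  by move/hasPn: fm => /(_ l); rewrite mem_iota/= ltlm elab lm eqxx => /(_ isT).
by move/hasPn: fl => /(_ m); rewrite mem_iota/= ltml elab lm eqxx => /(_ isT).
Qed.

Lemma class_firsts_mem n : [seq lab l | l <- class_firsts e n] =i label_word n.
Proof.
move=> i; apply/mapP/mapP => -[l]; first by rewrite mem_filter => /andP[_ ln] ->; exists l.
rewrite mem_iota/= => ln ->.
have ex : exists m, lab m == lab l by exists l.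
pose m := ex_minn ex; have [mE mmin] : lab m = lab l /\ (forall k, lab k = lab l -> (m <= k)%N).
  rewrite /m; case: ex_minnP => k /eqP kl kmin; split=> // j jl.
  by apply: kmin; rewrite jl.
exists m => //; rewrite mem_filter mem_iota/= (leq_ltn_trans (mmin l erefl) ln) andbT.
apply/hasPn => k; rewrite mem_iota/= => km; rewrite elab mE; apply/negP => /eqP kl.
by have := mmin k (esym kl); rewrite leqNgt km.
Qed.

Lemma class_countsE n : class_counts e n =
  [seq count_mem i (label_word n) | i <- [seq lab l | l <- class_firsts e n]].
Proof.
rewrite /class_counts -map_comp; apply: eq_map => l /=.
rewrite count_map; apply: eq_count => m /=.
by rewrite elab eq_sym.
Qed.

(** A sum over the classes does not depend on the order of their appearance and
    can be indexed by their labels. *)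
Lemma sum_class_counts (R : realType) (psi : nat -> R) n K : psi 0%N = 0 ->
  (forall l, (l < n)%N -> (lab l < K)%N) ->
  \sum_(j <- class_counts e n) psi j = \sum_(i < K) psi (count_mem (val i) (label_word n)).
Proof.
move=> psi0 labK; rewrite class_countsE big_map.
rewrite -(big_mkord xpredT (fun i => psi (count_mem i (label_word n)))) /index_iota subn0.
rewrite [RHS](bigID (fun i => i \in label_word n))/= [X in _ = _ + X]big1 ?addr0; last first.
  by move=> i; move/count_memPn => ->.
rewrite -[RHS]big_filter; apply: perm_big; apply: uniq_perm.
- exact: class_firsts_uniq.
- by rewrite filter_uniq// iota_uniq.
- move=> i; rewrite class_firsts_mem mem_filter mem_iota/=.
  rewrite andb_idr// => /mapP[l]; rewrite mem_iota/= => ln ->; exact: labK.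
Qed.

(** Labels are replaced by the rank of appearance of their class, which is what
    the counts refer to. *)
Definition rank_word (n : nat) :=
  [seq index (lab l) [seq lab k | k <- class_firsts e n] | l <- iota 0 n].

Lemma count_rank_word n j : count_mem j (rank_word n) = nth 0%N (class_counts e n) j.
Proof.
set u := [seq lab k | k <- class_firsts e n].
have -> : rank_word n = map (index^~ u) (label_word n) by rewrite -map_comp.
rewrite count_map.
rewrite class_countsE -/u.
have [ju|ju] := ltnP j (size u).
  rewrite (nth_map 0%N)//; apply: eq_in_count => y; rewrite -class_firsts_mem -/u => yu /=.
  apply/eqP/eqP => [<-|->]; first by rewrite nth_index.
  by rewrite index_uniq//; exact: class_firsts_uniq.
rewrite nth_default ?size_map//; last by rewrite size_map in ju.
apply/eqP; rewrite -leqn0 leqNgt -has_count; apply/hasPn => y.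
rewrite -class_firsts_mem -/u => yu /=; apply/eqP => yj.
by move: ju; rewrite -yj leqNgt index_mem yu.
Qed.

End labelling.

Lemma perm_below_of_word (w w' : seq nat) : perm_eq w' w ->
  exists sigma tau, perm_below (size w) sigma tau /\
    forall l, (l < size w)%N -> nth 0%N w' l = nth 0%N w (sigma l).
Proof.
move=> /(perm_iotaP 0%N)/= [Is pI w'E].
have sI : size Is = size w by rewrite (perm_size pI) size_iota.
have uI : uniq Is by rewrite (perm_uniq pI) iota_uniq.
have mI l : (l \in Is) = (l < size w)%N by rewrite (perm_mem pI) mem_iota.
exists (fun l => if (l < size w)%N then nth 0%N Is l else l),
  (fun l => if (l < size w)%N then index l Is else l); split; last first.
  by move=> l lw; rewrite w'E (nth_map 0%N) ?sI// lw.
split.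
- move=> l; have [lw|lw] := ltnP l (size w); last by rewrite ltnNge lw.
  have -> : (nth 0%N Is l < size w)%N by rewrite -mI mem_nth ?sI.
  by rewrite index_uniq ?sI.
- move=> l; have [lw|lw] := ltnP l (size w); last by rewrite ltnNge lw.
  have -> : (index l Is < size w)%N by rewrite -[X in (_ < X)%N]sI index_mem mI.
  by rewrite nth_index// mI.
- by move=> l; rewrite ltnNge => ->.
Qed.

(** The counts are the multiplicities of the letters of the rank word, so equal
    counts make the two rank words permutations of each other. *)
Lemma perm_below_of_class_counts (e e' : rel nat) (lab lab' : nat -> nat) n :
  (forall l m, e l m = (lab l == lab m)) ->
  (forall l m, e' l m = (lab' l == lab' m)) ->
  class_counts e n = class_counts e' n ->
  exists sigma tau, perm_below n sigma tau /\
    forall l m, (l < n)%N -> (m < n)%N -> e' l m = e (sigma l) (sigma m).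
Proof.
move=> elab elab' cE.
have [|sigma [tau [pb wE]]] := @perm_below_of_word (rank_word e lab n) (rank_word e' lab' n).
  apply/allP => j _; apply/eqP.
  by rewrite (count_rank_word elab) (count_rank_word elab') cE.
rewrite size_map size_iota in pb wE.
exists sigma, tau; split => // l m ln mn.
have sn k : (k < n)%N -> (sigma k < n)%N by rewrite (perm_below_ltn k pb (leqnn n)).
have rk (f : rel nat) g k : (k < n)%N ->
    nth 0%N (rank_word f g n) k = index (g k) [seq g k | k <- class_firsts f n].
  by move=> kn; rewrite (nth_map 0%N) ?size_iota// nth_iota.
have idx (f : rel nat) (g : nat -> nat) k k' :
    (forall l m, f l m = (g l == g m)) -> (k < n)%N -> (k' < n)%N ->
    (index (g k) [seq g k | k <- class_firsts f n] ==
     index (g k') [seq g k | k <- class_firsts f n]) = (g k == g k').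
  move=> fg kn k'n; apply/eqP/eqP => [|->//].
  have mk j : (j < n)%N -> g j \in [seq g k | k <- class_firsts f n].
    by move=> jn; rewrite (class_firsts_mem fg) map_f// mem_iota.
  by move=> /(congr1 (nth 0%N [seq g k | k <- class_firsts f n])); rewrite !nth_index// mk.
rewrite elab elab' -(idx e')// -(idx e)// ?sn//.
by rewrite -!rk// ?sn// -!wE.
Qed.

Section first_mate.
Variable e : rel nat.
Hypotheses (e_refl : reflexive e) (e_sym : symmetric e) (e_trans : transitive e).

(** A label of the class that is defined for every equivalence relation, also
    where some individual lies in no interval. *)
Definition first_mate (l : nat) : nat := find (e l) (iota 0 l.+1).

Lemma first_mateP l : e l (first_mate l).
Proof.
have h : has (e l) (iota 0 l.+1) by apply/hasP; exists l; rewrite ?mem_iota//= ltnS.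
have lt : (find (e l) (iota 0 l.+1) < l.+1)%N.
  by rewrite -[X in (_ < X)%N](size_iota 0 l.+1) -has_find.
by have := nth_find 0%N h; rewrite nth_iota.
Qed.

Lemma first_mate_min l k : e l k -> (first_mate l <= k)%N.
Proof.
move=> lk; rewrite leqNgt; apply/negP => h; have := before_find 0%N h.
rewrite nth_iota ?lk//; apply: (leq_trans h).
by rewrite -[X in (_ <= X)%N](size_iota 0 l.+1); exact: find_size.
Qed.

Lemma first_mate_eq l m : e l m = (first_mate l == first_mate m).
Proof.
apply/idP/eqP => [lm|lm].
  apply/eqP; rewrite eqn_leq; apply/andP; split; apply: first_mate_min.
    exact: e_trans lm (first_mateP m).
  by apply: e_trans (first_mateP l); rewrite e_sym.
apply: (e_trans (first_mateP l)); rewrite lm e_sym; exact: first_mateP.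
Qed.
End first_mate.

Lemma eq_label_word_first_mate (e e' : rel nat) n :
  reflexive e -> symmetric e -> transitive e ->
  reflexive e' -> symmetric e' -> transitive e' ->
  label_word (first_mate e) n = label_word (first_mate e') n <->
  forall l m, (l < n)%N -> (m < n)%N -> e l m = e' l m.
Proof.
move=> r s t r' s' t'; split => [E l m ln mn|E].
  have h k : (k < n)%N -> first_mate e k = first_mate e' k.
    move=> kn; have := congr1 (fun w => nth 0%N w k) E.
    by rewrite !(nth_map 0%N) ?size_iota// !nth_iota.
  by rewrite (first_mate_eq r)// (first_mate_eq r')// !h.
apply/eq_in_map => l; rewrite mem_iota/= => ln.
apply: eq_in_find => m; rewrite mem_iota/= ltnS => ml.
by apply: E => //; exact: leq_ltn_trans ln.
Qed.

(** * Plug-in estimators along a sample *)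

Lemma powR_le_id (R : realType) (x b : R) : 0 <= x <= 1 -> 1 <= b -> x `^ b <= x.
Proof.
move=> /andP[x0 x1] b1; have [->|xn0] := eqVneq x 0.
  by rewrite powR0// gt_eqF// (lt_le_trans _ b1).
by apply: ge1r_powR; rewrite ?x1 ?andbT ?lt_neqAle ?x0 1?eq_sym ?xn0.
Qed.

Section plugin.
Context (R : realType).

Lemma series_frequencies (psi : R -> R) n (c : seq nat) : psi 0 = 0 ->
  (\sum_(0 <= i <oo) (psi (frequencies R n c i))%:E =
   (\sum_(j <- c) psi (j%:R / n%:R))%:E)%E.
Proof.
move=> psi0; rewrite (big_nth 0%N) -sumEFin.
apply: lim_near_cst => //; near=> m.
have cm : (size c <= m)%N by near: m; exists (size c).
rewrite (big_cat_nat _ cm)//= [X in (_ + X)%E]big1_seq ?adde0//.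
move=> i; rewrite mem_index_iota => /andP[_ /andP[ci _]].
by rewrite /frequencies nth_default// mul0r psi0.
Unshelve. all: by end_near.
Qed.

Lemma gini_frequencies kappa n (c : seq nat) : 0 < kappa ->
  gini kappa (frequencies R n c) =
  (1 - \sum_(j <- c) (j%:R / n%:R) `^ (kappa + 1))%:E.
Proof.
move=> k0; rewrite /gini (series_frequencies (psi := fun x => x `^ (kappa + 1)))//.
by rewrite powR0// gt_eqF// addr_gt0.
Qed.

Lemma shannon_frequencies n (c : seq nat) :
  shannon (frequencies R n c) = (\sum_(j <- c) (j%:R / n%:R) * - ln (j%:R / n%:R))%:E.
Proof.
rewrite /shannon (series_frequencies (psi := fun x => x * ln x)) ?mul0r//.
by rewrite -EFinN -sumrN; congr EFin; apply: eq_bigr => j _; rewrite mulrN.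
Qed.

Variables (a : massPartition R -> nat -> R) (ha : interval_arrangement a).
Variables (s : massPartition R) (x : nat -> R).

Lemma same_species_refl : reflexive (same_species a s x).
Proof. by move=> l; rewrite /same_species eqxx. Qed.

Lemma same_species_sym : symmetric (same_species a s x).
Proof.
move=> l m; rewrite /same_species eq_sym; congr (_ || _).
by apply/asbool_equiv_eq; split => -[i []]; exists i.
Qed.

Lemma same_species_trans : transitive (same_species a s x).
Proof.
move=> m l k; rewrite /same_species => /orP[/eqP->//|/asboolP[i [il im]]].
move=> /orP[/eqP <-|/asboolP[j [jm jk]]].
  by apply/orP; right; apply/asboolP; exists i.
apply/orP; right; apply/asboolP; exists i; split => //.
by rewrite (@in_species_uniq _ _ ha (s, x m) i j).
Qed.

Lemma species_countsE n : species_counts a s x n = class_counts (same_species a s x) n.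
Proof. by []. Qed.

Hypothesis x_species : forall l, exists i, in_species a i (s, x l).

Definition species_label (l : nat) : nat := sval (cid (x_species l)).

Lemma species_labelP l : in_species a (species_label l) (s, x l).
Proof. by rewrite /species_label; case: cid. Qed.

Lemma species_label_eq l i : (species_label l == i) = (x l \in species_interval a s i).
Proof.
apply/eqP/idP => [<-|]; first by rewrite inE; exact: species_labelP.
by rewrite inE => il; apply: (in_species_uniq ha (species_labelP l)).
Qed.

Lemma same_species_label l m :
  same_species a s x l m = (species_label l == species_label m).
Proof.
rewrite /same_species; apply/orP/eqP => [[/eqP->//|/asboolP[i [il im]]]|lm].
  have /eqP -> : species_label l == i by rewrite species_label_eq inE.
  by apply/esym/eqP; rewrite species_label_eq inE.
right; apply/asboolP; exists (species_label l); split; first exact: species_labelP.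
by rewrite lm; exact: species_labelP.
Qed.

Let p i n := interval_frequency (species_interval a s i) x n.
Let supp n := (\max_(l < n) species_label l).+1.

Let label_supp l n : (l < n)%N -> (species_label l < supp n)%N.
Proof.
by move=> ln; rewrite /supp ltnS; exact: (leq_bigmax (Ordinal ln)).
Qed.

Let pE i n : p i n = (\sum_(l < n) (species_label l == i)%:R) / n%:R.
Proof.
by congr (_ / _); apply: eq_bigr => l _; rewrite indicE species_label_eq.
Qed.

Let p_count i n : p i n = (count_mem i (label_word species_label n))%:R / n%:R.
Proof.
rewrite pE; congr (_ / _); rewrite count_map -sum1_count natr_sum big_mkcond/=.
rewrite -(big_mkord xpredT (fun l => (species_label l == i)%:R)) /index_iota subn0.
by rewrite [RHS]big_mkcond/=; apply: eq_bigr => l _; case: ifP.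
Qed.

(** This turns the mean over individuals of the surprise into a sum over species. *)
Lemma sum_label_frequency (c : nat -> R) n M K : (supp n <= K)%N ->
  \sum_(M <= i < K) p i n * c i =
  (\sum_(l < n) (if (M <= species_label l)%N then c (species_label l) else 0)) / n%:R.
Proof.
move=> nK; under eq_bigr do rewrite pE mulrAC mulr_suml.
rewrite -mulr_suml; congr (_ / _); rewrite exchange_big/=; apply: eq_bigr => l _.
rewrite (eq_bigr (fun i => if i == species_label l then c i else 0)); last first.
  by move=> i _; rewrite eq_sym; case: eqP => _; rewrite ?mul1r ?mul0r.
rewrite -big_mkcond/= big_nat1_eq.
by rewrite (leq_trans (label_supp (ltn_ord l)) nK) andbT.
Qed.

Lemma sum_frequency n K : (0 < n)%N -> (supp n <= K)%N -> \sum_(i < K) p i n = 1.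
Proof.
move=> n0 nK; rewrite -(big_mkord xpredT (p ^~ n)).
under eq_bigr do rewrite -[p _ _]mulr1.
rewrite (sum_label_frequency (fun=> 1) 0 nK)/= sumr_const card_ord.
by rewrite divff// pnatr_eq0 -lt0n.
Qed.

Lemma sum_species_counts (psi : R -> R) n K : psi 0 = 0 -> (supp n <= K)%N ->
  \sum_(j <- species_counts a s x n) psi (j%:R / n%:R) = \sum_(i < K) psi (p i n).
Proof.
move=> psi0 nK; rewrite species_countsE.
rewrite (sum_class_counts same_species_label (psi := fun j => psi (j%:R / n%:R)) (K := K)).
- by apply: eq_bigr => i _; rewrite p_count.
- by rewrite mul0r.
- by move=> l ln; exact: leq_trans (label_supp ln) nK.
Qed.

Hypothesis p_cvg : forall i, p i n @[n --> \oo] --> s i.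

Let p_ge0 i n : 0 <= p i n.
Proof. by rewrite pE divr_ge0// sumr_ge0. Qed.

Let p_eq0 i n : s i = 0 -> p i n = 0.
Proof.
move=> si0; rewrite /p /interval_frequency big1 ?mul0r// => l _.
by rewrite /species_interval si0 addr0 set_itv_ge ?indic0// bnd_simp ltxx.
Qed.

Lemma cvg_powR_pos (b y : R) (u : nat -> R) : 0 < y -> u n @[n --> \oo] --> y ->
  u n `^ b @[n --> \oo] --> y `^ b.
Proof.
move=> y0 uy; apply: (cvg_comp u (fun z : R => z `^ b) uy).
have dy : derivable (fun z : R => z `^ b) y 1.
  by apply: derivable_powR; rewrite in_itv/= andbT.
by move/derivable1_diffP/differentiable_continuous : dy.
Qed.

Lemma cvg_plugin_gini kappa : 0 < kappa ->
  gini kappa (frequencies R n (species_counts a s x n)) @[n --> \oo] --> gini kappa s.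
Proof.
move=> k0; have k1 : 0 < kappa + 1 by rewrite addr_gt0.
under eq_fun do rewrite gini_frequencies// EFinB.
apply: cvgeB; [exact: fin_num_adde_defr|exact: cvg_cst|].
apply: (@cvg_sum_dominated R s p supp _ _ _ _ _ (fun y => y `^ (kappa + 1))) => //.
- by move=> i; exact: mass_ge0.
- exact: mass_sum1.
- exact: sum_frequency.
- by move=> y y01; rewrite powR_ge0 powR_le_id// lerDr ltW.
- move=> i; have [s0|sn0] := eqVneq (s i) 0.
    rewrite s0; under eq_fun do rewrite p_eq0//; exact: cvg_cst.
  by apply: cvg_powR_pos => //; rewrite lt_neqAle eq_sym sn0 mass_ge0.
- move=> n K nK; apply: (sum_species_counts (psi := fun y => y `^ (kappa + 1))) => //.
  by rewrite powR0// gt_eqF.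
Qed.

Hypothesis surprise_tail : forall e : R, 0 < e ->
  exists M, forall n, (\sum_(l < n.+1) surprise a M (s, x l)) / n.+1%:R <= e.

Lemma cvg_plugin_shannon : (shannon s < +oo)%E ->
  shannon (frequencies R n (species_counts a s x n)) @[n --> \oo] --> shannon s.
Proof.
move=> Hfin; rewrite (shannonE (mass_itv s)).
under eq_fun do rewrite shannon_frequencies.
apply: (@cvg_entropy_sum R s p supp) => //.
- by move=> i; exact: mass_ge0.
- exact: mass_sum1.
- exact: sum_frequency.
- move=> e e0; have [M HM] := surprise_tail e0; exists M => n K nK n0.
  rewrite (sum_label_frequency (fun i => - ln (s i)) M nK).
  case: n n0 nK => // n _ nK; apply: le_trans (HM n).
  rewrite le_eqVlt; apply/orP; left; apply/eqP; congr (_ / _); apply: eq_bigr => l _.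
  by rewrite (surpriseE ha M (species_labelP l)).
- by rewrite -(shannonE (mass_itv s)).
- move=> n K nK; apply: (sum_species_counts (psi := fun y => y * - ln y)) => //.
  by rewrite mul0r.
Qed.
End plugin.

(** * Levy's upward theorem *)

Section sigma_of_facts.
Context d (T : measurableType d).

(** For a countably valued V this is measurability with respect to V. *)
Definition determined_by U (V : T -> seq nat) (f : T -> U) : Prop :=
  forall w w', V w = V w' -> f w = f w'.

Lemma sigma_of_determined U (V : T -> seq nat) (f : T -> U) (B : set U) :
  determined_by V f -> sigma_of V (f @^-1` B).
Proof.
move=> Vf; exists (V @` (f @^-1` B)) => //; apply/seteqP; split => w /=.
  by move=> [w' Bw' VE]; rewrite -(Vf _ _ VE).
by move=> Bw; exists w.
Qed.

Lemma measurable_sigma_of (V : T -> seq nat) (A : set T) :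
  (forall c, measurable (V @^-1` [set c])) -> sigma_of V A -> measurable A.
Proof.
move=> mV [C _ <-].
pose dec (j : nat) : option (seq nat) := unpickle j.
have decK c : dec (pickle c) = Some c by exact: pickleK.
rewrite (_ : V @^-1` C = \bigcup_(j in [set j | exists2 c, dec j = Some c & C c])
    (V @^-1` [set odflt [::] (dec j)])).
  by apply: bigcup_measurable => j _; exact: mV.
apply/seteqP; split => w /=.
  move=> Cw; exists (pickle (V w)); first by exists (V w).
  by change (V w = odflt [::] (dec (pickle (V w)))); rewrite decK.
move=> [j [c jc Cc] jw]; have -> : V w = c by rewrite (jw : V w = odflt [::] (dec j)) jc.
by [].
Qed.

Lemma subalgebra_sigma_of (V : T -> seq nat) :
  (forall c, measurable (V @^-1` [set c])) -> subalgebra (sigma_of V).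
Proof.
move=> mV; split; first by move=> A; exact: measurable_sigma_of.
- by move=> _ _ [C _ <-] [D _ <-]; exists (C `|` D).
- by move=> _ _ [C _ <-] [D _ <-]; exists (C `\` D).
Qed.

Lemma sigma_of_sub (V V' : T -> seq nat) : determined_by V' V ->
  sigma_of V `<=` sigma_of V'.
Proof. by move=> VV _ [C _ <-]; exact: sigma_of_determined. Qed.

Lemma measurable_determined d' (U : measurableType d') (V : T -> seq nat) (f : T -> U) :
  (forall c, measurable (V @^-1` [set c])) -> determined_by V f ->
  measurable_fun setT f.
Proof.
move=> mV Vf _ B mB; rewrite setTI.
by apply: (measurable_sigma_of mV); exact: sigma_of_determined.
Qed.
End sigma_of_facts.

Lemma cvge0_near_le (R : realType) (u : nat -> \bar R) :
  (forall n, 0 <= u n)%E ->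
  (forall e : R, 0 < e -> \forall n \near \oo, (u n <= e%:E)%E) ->
  u n @[n --> \oo] --> 0%E.
Proof.
move=> u0 H.
have fin (e : R) n : (u n <= e%:E)%E -> u n \is a fin_num.
  by move=> ue; rewrite ge0_fin_numE//; exact: le_lt_trans ue (ltry _).
apply/fine_cvgP; split; first by apply: filterS (H 1 ltr01) => n; exact: fin.
apply/cvgr0Pnorm_le => e e0; apply: filterS (H e e0) => n ue /=.
by rewrite ger0_norm ?fine_ge0// -lee_fin fineK// (fin _ _ ue).
Qed.

Section levy.
Context d (T : measurableType d) (R : realType) (mu : probability T R).
Variable K : nat -> T -> seq nat.
Hypothesis mK : forall n c, measurable (K n @^-1` [set c]).
Hypothesis K_refine : forall n m, (n <= m)%N -> determined_by (K m) (K n).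
Local Open Scope ereal_scope.

Let sub n := subalgebra_sigma_of (mK n).

Variables (g : T -> R) (y : nat -> T -> R).
Hypothesis ig : mu.-integrable setT (EFin \o g).
Hypothesis iy : forall n, mu.-integrable setT (EFin \o y n).
Hypothesis Ky : forall n, determined_by (K n) (y n).
Hypothesis cond : forall n A, sigma_of (K n) A ->
  \int[mu]_(w in A) (y n w)%:E = \int[mu]_(w in A) (g w)%:E.

Section approximation.
Variables (m : nat) (h : T -> R).
Hypothesis ih : mu.-integrable setT (EFin \o h).
Hypothesis Kh : determined_by (K m) h.

Let igh : mu.-integrable setT (EFin \o (fun w => g w - h w)%R).
Proof.
by have := integrableB measurableT ig ih; apply: eq_integrable => // w _; rewrite /= EFinB.
Qed.

Let iyh n : mu.-integrable setT (EFin \o (fun w => y n w - h w)%R).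
Proof.
by have := integrableB measurableT (iy n) ih; apply: eq_integrable => // w _; rewrite /= EFinB.
Qed.

Let Kyh n : (m <= n)%N -> determined_by (K n) (fun w => y n w - h w)%R.
Proof.
move=> mn w w' E; rewrite (Ky E); congr (_ - _)%R; apply: Kh; exact: K_refine E.
Qed.

Let cond_diff n A : sigma_of (K n) A ->
  \int[mu]_(w in A) (y n w - h w)%:E = \int[mu]_(w in A) (g w - h w)%:E.
Proof.
move=> sA; have mA := subalgebra_measurable (sub n) sA.
have iA (f : T -> R) : mu.-integrable setT (EFin \o f) -> mu.-integrable A (EFin \o f).
  by apply: integrableS.
under eq_integral do rewrite EFinB; rewrite integralB_EFin; [|exact: mA|exact: iA|exact: iA].
under [RHS]eq_integral do rewrite EFinB; rewrite integralB_EFin; [|exact: mA|exact: iA|exact: iA].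
by rewrite cond.
Qed.

Let neg_int (f : T -> R) : mu.-integrable setT (EFin \o f) ->
  mu.-integrable setT (EFin \o (fun w => - f w)%R).
Proof. by move=> /integrableN; apply: eq_integrable => // w _; rewrite /= EFinN. Qed.

Let delta := \int[mu]_w `|(g w - h w)%:E|.

(** From time m on, y n - h is the conditional expectation of g - h. *)
Lemma maximal_approximation (e : R) : (0 < e)%R ->
  e%:E * mu (\bigcup_k [set w | (e < `|y (m + k) w - h w|)%R]) <= 2%:E * delta.
Proof.
move=> e0.
have nd : {homo (fun k => sigma_of (K (m + k))) : n k / (n <= k)%N >-> n `<=` k}.
  by move=> n k nk; apply: sigma_of_sub; apply: K_refine; rewrite leq_add2l.
have H1 : e%:E * mu (\bigcup_k [set w | (e < y (m + k) w - h w)%R]) <= delta.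
  apply: (@maximal_gt _ _ _ mu (fun k => sigma_of (K (m + k)%N)) (fun w => g w - h w)%R
    (fun k w => y (m + k) w - h w)%R e (ltW e0)) => //.
  - by move=> k; apply: (sigma_of_determined [set x | (e < x)%R] (Kyh (leq_addr _ _))).
  - by move=> k A; exact: cond_diff.
have H2 : e%:E * mu (\bigcup_k [set w | (e < - (y (m + k) w - h w))%R]) <= delta.
  have -> : delta = \int[mu]_w `|(- (g w - h w))%:E|.
    by apply: eq_integral => w _; rewrite EFinN abseN.
  apply: (@maximal_gt _ _ _ mu (fun k => sigma_of (K (m + k)%N)) (fun w => - (g w - h w))%R
    (fun k w => - (y (m + k) w - h w))%R e (ltW e0)) => //.
  - exact: neg_int.
  - by move=> k; apply: neg_int.
  - by move=> k; apply: (sigma_of_determined [set x | (e < - x)%R] (Kyh (leq_addr _ _))).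
  - move=> k A sA; have mA := subalgebra_measurable (sub (m + k)%N) sA.
    under eq_integral do rewrite EFinN; under [RHS]eq_integral do rewrite EFinN.
    rewrite !integralN/=; first by rewrite cond_diff.
      by apply: integrable_add_def => //; exact: integrableS igh.
    by apply: integrable_add_def => //; exact: integrableS (iyh _).
have mm k : measurable_fun setT (fun w => y (m + k) w - h w)%R.
  by apply/measurable_EFinP; case/integrableP: (iyh (m + k)).
apply: le_trans (lee_wpmul2l _ (measure_bigcup_gt_normr mu e mm)) _.
  by rewrite lee_fin ltW.
rewrite ge0_muleDr// (_ : 2%:E = 1 + 1); last by rewrite -EFinD.
by rewrite ge0_muleDl// mul1e; exact: leeD.
Qed.

Lemma integral_approximation n : (m <= n)%N ->
  \int[mu]_w `|(y n w - h w)%:E| <= delta.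
Proof.
move=> mn; pose A := [set w | (0 <= y n w - h w)%R].
have sA : sigma_of (K n) A by exact: (sigma_of_determined [set x | (0 <= x)%R] (Kyh mn)).
have sCA : sigma_of (K n) (~` A).
  by exact: (sigma_of_determined [set x | ~ (0 <= x)%R] (Kyh mn)).
have mA := subalgebra_measurable (sub n) sA.
have mCA := subalgebra_measurable (sub n) sCA.
have split_A (f : T -> R) : mu.-integrable setT (EFin \o f) ->
    \int[mu]_w `|(f w)%:E| = \int[mu]_(w in A) `|(f w)%:E| + \int[mu]_(w in ~` A) `|(f w)%:E|.
  move=> iF; rewrite -[in LHS](setUv A) ge0_integral_setU//.
    apply: measurable_funTS; apply: measurableT_comp => //.
    by case/integrableP: iF.
  by apply/disj_setPS => w [].
rewrite /delta (split_A _ (iyh n)) (split_A _ igh); apply: leeD.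
- rewrite (eq_integral (fun w => (y n w - h w)%:E)).
    rewrite cond_diff//; apply: le_integral => //.
    + exact: integrableS igh.
    + by apply: integrable_abse; exact: integrableS igh.
    + by move=> w _; exact: lee_abs.
  by move=> w /set_mem yh; apply: gee0_abs; rewrite lee_fin.
- rewrite (eq_integral (fun w => - (y n w - h w)%:E)); last first.
    by move=> w /set_mem /negP; rewrite -ltNge => yh; rewrite lte0_abs.
  rewrite integralN; last by apply: integrable_add_def => //; exact: integrableS (iyh n).
  rewrite cond_diff// -integralN; last by apply: integrable_add_def => //; exact: integrableS igh.
  apply: le_integral => //.
  + by apply: integrableN; exact: integrableS igh.
  + by apply: integrable_abse; exact: integrableS igh.
  + by move=> w _; rewrite -abseN; exact: lee_abs.
Qed.

Lemma markov_approximation (e : R) : (0 < e)%R ->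
  e%:E * mu [set w | (e < `|g w - h w|)%R] <= delta.
Proof.
move=> e0; apply: le_trans (le_integral_abse mu measurableT _ e0); last first.
  by case/integrableP: igh.
apply: lee_wpmul2l; first by rewrite lee_fin ltW.
have mgh : measurable_fun setT (fun w => `|g w - h w|)%R.
  by apply: measurableT_comp => //; apply/measurable_EFinP; case/integrableP: igh.
apply: le_measure; rewrite ?inE.
- exact: measurable_set_gt.
- rewrite setTI [X in measurable X](_ : _ = (fun w => `|g w - h w|)%R @^-1` `[e, +oo[%classic).
    by rewrite -[X in measurable X]setTI; apply: mgh.
  by apply/seteqP; split => w /=; rewrite in_itv/= andbT lee_fin.
- by move=> w /= lt; split => //=; rewrite lee_fin ltW.
Qed.
End approximation.

Hypothesis approximable : forall e : R, (0 < e)%R -> exists m (h : T -> R),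
  [/\ mu.-integrable setT (EFin \o h), determined_by (K m) h &
      \int[mu]_w `|(g w - h w)%:E| <= e%:E].

(** For n >= m, |y n - g| <= |y n - h| + |g - h|, and both terms are small outside
    an event of small probability, uniformly in n, if h is close to g in L1. *)
Lemma levy_ae : {ae mu, forall w, y n w @[n --> \oo] --> g w}.
Proof.
have mg : measurable_fun setT g by apply/measurable_EFinP; case/integrableP: ig.
have my n : measurable_fun setT (y n) by apply/measurable_EFinP; case/integrableP: (iy n).
have : {ae mu, forall w, (y n w - g w)%R @[n --> \oo] --> (0 : R)%R}.
  apply: ae_cvg0_of_tail; first by move=> n; exact: measurable_funB.
  move=> e eta e0 eta0.
  (* at level e / 2 the maximal inequality costs 2 and Markov's inequality 1
     times the distance, and (2 + 1) * (e * eta / 6) = eta * (e / 2) *)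
  have [|m [h [ih Kh hle]]] := approximable (e := (e * eta / 6)%R).
    by rewrite divr_gt0// mulr_gt0.
  have mh : measurable_fun setT h by apply/measurable_EFinP; case/integrableP: ih.
  have e2 : (0 < e / 2)%R by rewrite divr_gt0.
  exists m.
  pose B1 := \bigcup_k [set w | (e / 2 < `|y (m + k)%N w - h w|)%R].
  pose B2 := [set w | (e / 2 < `|g w - h w|)%R].
  have mB1 : measurable B1.
    apply: bigcupT_measurable => k; apply: measurable_set_gt.
    by apply: measurableT_comp => //; exact: measurable_funB.
  have mB2 : measurable B2.
    by apply: measurable_set_gt; apply: measurableT_comp => //; exact: measurable_funB.
  have sB : \bigcup_k [set w | (e < `|y (m + k)%N w - g w|)%R] `<=` B1 `|` B2.
    move=> w [k _ /= lt].
    have [le2|gt2] := leP `|g w - h w|%R (e / 2)%R; [left|by right].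
    exists k => //=; rewrite ltNge; apply/negP => le1.
    have := ler_distD (h w) (y (m + k) w) (g w); rewrite (distrC (h w)); lra.
  have H1 := maximal_approximation ih Kh e2.
  have H2 := markov_approximation ih e2.
  rewrite -(@lee_pmul2l _ (e / 2)%:E)// ?lte_fin//.
  apply: (@le_trans _ _ ((e / 2)%:E * (mu B1 + mu B2))).
    apply: lee_wpmul2l; first by rewrite lee_fin ltW.
    apply: le_trans (measureU2 _ mB1 mB2); apply: le_measure; rewrite ?inE//.
      apply: bigcupT_measurable => k; apply: measurable_set_gt.
      by apply: measurableT_comp => //; exact: measurable_funB.
    exact: measurableU.
  rewrite ge0_muleDr//; apply: le_trans (leeD H1 H2) _.
  apply: (@le_trans _ _ (2%:E * (e * eta / 6)%:E + (e * eta / 6)%:E)).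
    by apply: leeD => //; apply: lee_wpmul2l.
  by rewrite -!EFinM -EFinD lee_fin; lra.
by apply: filterS => w H; apply/subr_cvg0.
Qed.

Lemma levy_L1 : \int[mu]_w `|(y n w - g w)%:E| @[n --> \oo] --> 0.
Proof.
have mg : measurable_fun setT g by apply/measurable_EFinP; case/integrableP: ig.
have my n : measurable_fun setT (y n) by apply/measurable_EFinP; case/integrableP: (iy n).
have bnd (e : R) : (0 < e)%R -> \forall n \near \oo, \int[mu]_w `|(y n w - g w)%:E| <= e%:E.
  move=> e0; have [|m [h [ih Kh hle]]] := approximable (e := (e / 2)%R).
    by rewrite divr_gt0.
  have mh : measurable_fun setT h by apply/measurable_EFinP; case/integrableP: ih.
  have mabs (u v : T -> R) : measurable_fun setT u -> measurable_fun setT v ->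
      measurable_fun setT (fun w => `|(u w - v w)%:E|).
    move=> mu' mv; apply: measurableT_comp => //.
    by apply/measurable_EFinP; exact: measurable_funB.
  exists m => // n mn /=.
  apply: (@le_trans _ _ (\int[mu]_w (`|(y n w - h w)%:E| + `|(g w - h w)%:E|))).
    apply: ge0_le_integral => //.
    - exact: mabs.
    - by apply: emeasurable_funD; exact: mabs.
    - move=> w _; rewrite -EFinD lee_fin.
      by have := ler_distD (h w) (y n w) (g w); rewrite (distrC (h w)).
  rewrite ge0_integralD//; last 2 first.
  - exact: mabs.
  - exact: mabs.
  apply: (@le_trans _ _ ((e / 2)%:E + (e / 2)%:E)); last by rewrite -EFinD -splitr.
  by apply: leeD => //; exact: le_trans (integral_approximation ih Kh mn) hle.
apply: cvge0_near_le bnd => n; exact: integral_ge0.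
Qed.
End levy.

(** * Approximation by functions of the history and convergence in Lp *)

Lemma cvg_minl (R : realType) (u : nat -> R) (l c : R) :
  u n @[n --> \oo] --> l -> Num.min (u n) c @[n --> \oo] --> Num.min l c.
Proof.
move=> /cvgrPdist_le ul; apply/cvgrPdist_le => e e0.
apply: filterS (ul e e0) => n; apply: le_trans.
have h1 := ler_norm (l - u n); have h2 := ler_norm (u n - l).
rewrite distrC in h2; have h0 := normr_ge0 (l - u n).
rewrite ler_norml /Num.min.
by case: (ltP l c) => ?; case: (ltP (u n) c) => ?; apply/andP; split; lra.
Qed.

Section Lp_convergence.
Context d (T : measurableType d) (R : realType) (mu : probability T R).
Local Open Scope ereal_scope.

(** Truncation at a level M makes the convergence bounded, and g is close in L1
    to its truncation. *)
Lemma approximable_of_ae_cvg (K : nat -> T -> seq nat) (g : T -> R) (h : nat -> T -> R) :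
  (forall n c, measurable (K n @^-1` [set c])) ->
  mu.-integrable setT (EFin \o g) -> (forall w, 0 <= g w)%R ->
  (forall n w, 0 <= h n w)%R -> (forall n, determined_by (K n) (h n)) ->
  {ae mu, forall w, h n w @[n --> \oo] --> g w} ->
  forall e : R, (0 < e)%R -> exists m (h' : T -> R),
  [/\ mu.-integrable setT (EFin \o h'), determined_by (K m) h' &
      \int[mu]_w `|(g w - h' w)%:E| <= e%:E].
Proof.
move=> mK ig g0 h0 Kh hg e e0.
have mg : measurable_fun setT g by apply/measurable_EFinP; case/integrableP: ig.
have mh n : measurable_fun setT (h n) by exact: measurable_determined (mK n) (Kh n).
have e2 : (0 < (e / 2)%:E) by rewrite lte_fin divr_gt0.
have mgM (M : R) : measurable_fun setT (fun w => Num.min (g w) M).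
  exact: measurable_minr.
have mhM n (M : R) : measurable_fun setT (fun w => Num.min (h n w) M).
  exact: measurable_minr.
have mabs (u v : T -> R) : measurable_fun setT u -> measurable_fun setT v ->
    measurable_fun setT (fun w => `|(u w - v w)%:E|).
  move=> mu' mv; apply: measurableT_comp => //.
  by apply/measurable_EFinP; exact: measurable_funB.
have [M HM] : exists M : nat, \int[mu]_w `|(g w - Num.min (g w) M%:R)%:E| <= (e / 2)%:E.
  have [] // := @dominated_convergence _ _ _ mu setT measurableT
    (fun n w => (Num.min (g w) n%:R)%:E) (EFin \o g) (EFin \o g).
  - by move=> n; exact/measurable_EFinP.
  - exact/measurable_EFinP.
  - apply: aeW => w _; apply: cvg_near_cst; near=> n.
    congr EFin; apply/min_idPl; near: n.
    exists (Num.truncn (g w)).+1 => // n /= gn.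
    by rewrite (le_trans (ltW (truncnS_gt (g w))))// ler_nat.
  - apply: aeW => w n _; rewrite lee_fin ger0_norm ?ge_min ?lexx//.
    by rewrite le_min g0 ler0n.
  - move=> _ + _ => /(_ _ (open_ereal_lt' e2))[M _ /(_ M (leqnn M)) /= HM]; exists M.
    rewrite (eq_integral (fun w => `|(Num.min (g w) M%:R)%:E - (g w)%:E|)) ?ltW//.
    by move=> w _; rewrite -EFinB -abseN -EFinN opprB.
have [m Hm] : exists m, \int[mu]_w `|(Num.min (h m w) M%:R - Num.min (g w) M%:R)%:E|
    <= (e / 2)%:E.
  have [] // := @dominated_convergence _ _ _ mu setT measurableT
    (fun n w => (Num.min (h n w) M%:R)%:E) (fun w => (Num.min (g w) M%:R)%:E)
    (fun=> (M%:R)%:E).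
  - by move=> n; exact/measurable_EFinP.
  - exact/measurable_EFinP.
  - by apply: filterS hg => w hgw _; apply: cvg_EFin; [exact: nearW|exact: cvg_minl].
  - exact: finite_measure_integrable_cst.
  - apply: aeW => w n _; rewrite lee_fin ger0_norm ?ge_min ?lexx ?orbT//.
    by rewrite le_min h0 ler0n.
  - by move=> _ + _ => /(_ _ (open_ereal_lt' e2))[m _ /(_ m (leqnn m)) /= Hm]; exists m; exact: ltW.
exists m, (fun w => Num.min (h m w) M%:R); split.
- apply: (@integrable_le_cst _ _ _ _ _ M%:R) => // w.
  by rewrite ger0_norm ?ge_min ?lexx ?orbT// le_min h0 ler0n.
- by move=> w w' E; rewrite (Kh _ _ _ E).
- apply: (@le_trans _ _ (\int[mu]_w (`|(g w - Num.min (g w) M%:R)%:E| +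
      `|(Num.min (h m w) M%:R - Num.min (g w) M%:R)%:E|))).
    apply: ge0_le_integral => //.
    + exact: mabs.
    + by apply: emeasurable_funD; exact: mabs.
    + move=> w _; rewrite -EFinD lee_fin.
      have := ler_distD (Num.min (g w) M%:R) (g w) (Num.min (h m w) M%:R).
      by rewrite (distrC (Num.min (g w) M%:R) (Num.min (h m w) M%:R)).
  rewrite ge0_integralD//; [|exact: mabs|exact: mabs].
  apply: (@le_trans _ _ ((e / 2)%:E + (e / 2)%:E)); last by rewrite -EFinD -splitr.
  exact: leeD.
Unshelve. all: by end_near.
Qed.

(** A difference r of numbers of [0, 1] satisfies |r|^p <= |r|. *)
Lemma bounded_cvg_Lp (F : nat -> T -> \bar R) (Z : T -> \bar R) (p : R) : (1 <= p)%R ->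
  (forall n, measurable_fun setT (F n)) -> measurable_fun setT Z ->
  (forall n, {ae mu, forall w, 0 <= F n w <= 1}) -> {ae mu, forall w, 0 <= Z w <= 1} ->
  \int[mu]_w `|F n w - Z w| @[n --> \oo] --> 0 ->
  cvg_Lp mu p F Z.
Proof.
move=> p1 mF mZ F01 Z01 FZ.
have p0 : (0 < p)%R by exact: lt_le_trans p1.
have fin (f : T -> \bar R) : measurable_fun setT f -> {ae mu, forall w, 0 <= f w <= 1} ->
    in_Lp mu p f.
  move=> mf f01; split => //; rewrite unlock; apply: poweR_lty.
  apply: (@le_lt_trans _ _ (\int[mu]_w 1)); last by rewrite integral_cst_probability ltry.
  apply: ae_ge0_le_integral => //.
  - by move=> w _; exact: poweR_ge0.
  - by apply: (measurableT_comp (measurable_poweR p)); exact: measurableT_comp.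
  - apply: filterS f01 => w /andP[f0 f1] _; rewrite gee0_abs//.
    by rewrite -(poweR1r p); apply: gt0_ler_poweR; rewrite ?in_itv/= ?leey ?andbT// ltW.
split; [by move=> n; exact: fin|exact: fin|].
apply: cvge0_near_le => [n|e e0]; first exact: Lnorm_ge0.
have ep : 0 < (e `^ p)%:E by rewrite lte_fin powR_gt0.
have [m _ H] := FZ _ (open_ereal_lt' ep); exists m => // n mn.
rewrite unlock -[e%:E](_ : (e `^ p)%:E `^ p^-1 = _); last first.
  by rewrite poweR_EFin -powRrM divff ?gt_eqF// powRr1// ltW.
apply: gt0_ler_poweR; rewrite ?in_itv/= ?leey ?andbT ?invr_ge0 ?(ltW p0)//.
- by apply: integral_ge0 => w _; exact: poweR_ge0.
- exact: ltW.
apply: le_trans (ltW (H n mn)).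
apply: ae_ge0_le_integral => //.
- by move=> w _; exact: poweR_ge0.
- apply: (measurableT_comp (measurable_poweR p)); apply: measurableT_comp => //.
  exact: emeasurable_funB.
- by apply: measurableT_comp => //; exact: emeasurable_funB.
apply: filterS2 (F01 n) Z01 => w.
case: (F n w) => [x| |]; case: (Z w) => [z| |]; rewrite ?lee_fin;
  try (by move=> /andP[]); try by move=> _ /andP[].
move=> /andP[x0 x1] /andP[z0 z1] _.
change ((`|x - z|%R)%:E `^ p <= (`|x - z|%R)%:E); rewrite poweR_EFin lee_fin.
have [->|r0] := eqVneq `|x - z|%R 0%R; first by rewrite powR0 ?gt_eqF.
apply: ge1r_powR => //; rewrite lt_neqAle eq_sym r0 normr_ge0/= ler_norml.
by apply/andP; split; lra.
Qed.

Lemma cond_expectation_itv01 (V : T -> seq nat) (y g : T -> R) :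
  (forall c, measurable (V @^-1` [set c])) -> determined_by V y ->
  mu.-integrable setT (EFin \o y) -> mu.-integrable setT (EFin \o g) ->
  (forall A, sigma_of V A -> \int[mu]_(w in A) (y w)%:E = \int[mu]_(w in A) (g w)%:E) ->
  (forall w, 0 <= g w <= 1)%R -> {ae mu, forall w, (0 <= y w <= 1)%R}.
Proof.
move=> mV Vy iy ig cond g01.
have key (u v : T -> R) : determined_by V u ->
    mu.-integrable setT (EFin \o u) -> mu.-integrable setT (EFin \o v) ->
    (forall A, sigma_of V A -> \int[mu]_(w in A) (u w)%:E = \int[mu]_(w in A) (v w)%:E) ->
    (forall w, (v w <= 0)%R) -> {ae mu, forall w, (u w <= 0)%R}.
  move=> Vu iu iv cuv v0; pose A := [set w | (0 < u w)%R].
  have sA : sigma_of V A by exact: (sigma_of_determined [set x | (0 < x)%R] Vu).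
  have mA := measurable_sigma_of mV sA.
  have muA : measurable_fun A (EFin \o u) by apply: measurable_funTS; case/integrableP: iu.
  have I0 : \int[mu]_(w in A) `|(EFin \o u) w| = 0.
    apply/eqP; rewrite eq_le integral_ge0// andbT.
    rewrite (eq_integral (fun w => (u w)%:E)); last first.
      by move=> w /set_mem Aw /=; rewrite gtr0_norm.
    rewrite cuv// -(integral0 mu A); apply: le_integral => //.
    - exact: integrableS iv.
    - exact: integrable0.
    - by move=> w _; rewrite lee_fin.
  have [N [mN N0 sN]] := (ae_eq_integral_abs mu mA muA).1 I0.
  exists N; split => // w /= nw; apply: sN => /= H; apply: nw.
  rewrite leNgt; apply/negP => uw; have := H uw; case => u0.
  by rewrite u0 ltxx in uw.
have i1 : mu.-integrable setT (EFin \o (fun=> 1%R : R)).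
  exact: finite_measure_integrable_cst.
have iN (f : T -> R) : mu.-integrable setT (EFin \o f) ->
    mu.-integrable setT (EFin \o (fun w => - f w)%R).
  by move=> /integrableN; apply: eq_integrable => // w _; rewrite /= EFinN.
have iB (f : T -> R) : mu.-integrable setT (EFin \o f) ->
    mu.-integrable setT (EFin \o (fun w => f w - 1)%R).
  move=> if'; have := integrableB measurableT if' i1.
  by apply: eq_integrable => // w _; rewrite /= EFinB.
have le1 : {ae mu, forall w, (y w - 1 <= 0)%R}.
  apply: (key _ (fun w => g w - 1)%R) => //; [|exact: iB|exact: iB| |].
  - by move=> w w' E; rewrite (Vy _ _ E).
  - move=> A sA; have mA := measurable_sigma_of mV sA.
    under eq_integral do rewrite EFinB.
    rewrite integralB_EFin//; [|exact: integrableS iy|exact: integrableS i1].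
    under [RHS]eq_integral do rewrite EFinB.
    rewrite integralB_EFin//; [|exact: integrableS ig|exact: integrableS i1].
    by rewrite cond.
  - by move=> w; case/andP: (g01 w); rewrite subr_le0.
have ge0 : {ae mu, forall w, (- y w <= 0)%R}.
  apply: (key _ (fun w => - g w)%R) => //; [|exact: iN|exact: iN| |].
  - by move=> w w' E; rewrite (Vy _ _ E).
  - move=> A sA; have mA := measurable_sigma_of mV sA.
    under eq_integral do rewrite EFinN; rewrite integralN; last first.
      by apply: integrable_add_def => //; exact: integrableS iy.
    under [RHS]eq_integral do rewrite EFinN; rewrite integralN; last first.
      by apply: integrable_add_def => //; exact: integrableS ig.
    by rewrite cond.
  - by move=> w; case/andP: (g01 w); rewrite oppr_le0.
by apply: filterS2 le1 ge0 => w; rewrite subr_le0 oppr_le0 => -> ->.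
Qed.
End Lp_convergence.

(** * Sufficiency of the counts *)

Section sufficiency.
Context (R : realType).
Variables (a : massPartition R -> nat -> R) (ha : interval_arrangement a).

Local Notation smp := (sample R (massPartition R)).

Definition agree (e : rel nat) (n : nat) : set smp :=
  [set u | forall l m, (l < n)%N -> (m < n)%N -> same_species a u.1 u.2 l m = e l m].

Lemma measurable_same_species l m : measurable [set u : smp | same_species a u.1 u.2 l m].
Proof.
have [lm|lm] := eqVneq l m.
  rewrite [X in measurable X](_ : _ = setT)//; apply/seteqP; split => u //= _.
  by rewrite /same_species lm eqxx.
pose D i k := [set u : smp | in_species a i (u.1, u.2 k)].
have mD i k : measurable (D i k).
  have mf : measurable_fun setT (fun u : smp => (u.1, u.2 k)).
    by apply: measurable_fun_pair; [exact: measurable_sample_fst|exact: measurable_sample_snd].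
  by have := mf measurableT _ (measurable_in_species ha i); rewrite setTI.
rewrite [X in measurable X](_ : _ = \bigcup_i (D i l `&` D i m)).
  by apply: bigcupT_measurable => i; exact: measurableI.
apply/seteqP; split => u /=.
  by rewrite /same_species (negbTE lm)/= => /asboolP[i [il im]]; exists i.
by move=> [i _ [il im]]; apply/orP; right; apply/asboolP; exists i.
Qed.

Lemma measurable_agree e n : measurable (agree e n).
Proof.
rewrite [X in measurable X](_ : _ = \bigcap_(l in `I_n) \bigcap_(m in `I_n)
    [set u : smp | same_species a u.1 u.2 l m = e l m]).
  apply: fin_bigcap_measurable => // l _; apply: fin_bigcap_measurable => // m _.
  have mlm := measurable_same_species l m.
  case: (e l m); first exact: mlm.
  rewrite [X in measurable X](_ : _ = ~` [set u : smp | same_species a u.1 u.2 l m]).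
    exact: measurableC.
  by apply/seteqP; split => u /=; [move=> ->|move/negP/negbTE].
by apply/seteqP; split => u /= H; [move=> l ln m mn|move=> l m ln mn]; exact: H.
Qed.

Lemma same_species_perm n sigma tau (s : massPartition R) (x : nat -> R) l m :
  perm_below n sigma tau ->
  same_species a s (x \o sigma) l m = same_species a s x (sigma l) (sigma m).
Proof.
by move=> pb; rewrite /same_species (can_eq (perm_belowK pb)).
Qed.

Context d (Omega : measurableType d) (PP : probability Omega R).
Variables (S : {RV PP >-> massPartition R}) (X : nat -> {RV PP >-> R}).
Hypothesis X_id : forall l (B : set R), measurable B ->
  PP (X l @^-1` B) = PP (X 0%N @^-1` B).
Hypothesis indep : mutually_independent S X.

Definition same_at (w : Omega) : rel nat := same_species a (S w) (fun l => X l w).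

(** The word of first mates encodes the partition of the first n individuals.
    Unlike the counts, which do not tell the species of the last individual, the
    histories refine one another as n grows. *)
Definition history (n : nat) (w : Omega) : seq nat :=
  label_word (first_mate (same_at w)) n.

Definition counts_at (n : nat) (w : Omega) : seq nat :=
  species_counts a (S w) (fun l => X l w) n.

Lemma historyP n w w' : history n w = history n w' <->
  forall l m, (l < n)%N -> (m < n)%N -> same_at w l m = same_at w' l m.
Proof.
apply: eq_label_word_first_mate => //;
  [exact: same_species_refl|exact: same_species_sym|exact: same_species_trans|
   exact: same_species_refl|exact: same_species_sym|exact: same_species_trans].
Qed.

Lemma history_fibre n w0 :
  history n @^-1` [set history n w0] = sampling S X id @^-1` agree (same_at w0) n.
Proof. by apply/seteqP; split => w /= /historyP. Qed.

Lemma measurable_history n c : measurable (history n @^-1` [set c]).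
Proof.
have [[w0 <-]|nc] := pselect (exists w, history n w = c).
  rewrite history_fibre -[X in measurable X]setTI.
  by apply: measurable_sampling => //; exact: measurable_agree.
rewrite (_ : _ @^-1` _ = set0)//; apply/seteqP; split => w //= wc.
by apply: nc; exists w.
Qed.

Lemma history_refine n m : (n <= m)%N -> determined_by (history m) (history n).
Proof.
move=> nm w w' /historyP H; apply/historyP => l k ln kn.
by apply: H; exact: leq_trans nm.
Qed.

Lemma counts_determined n : determined_by (history n) (counts_at n).
Proof. by move=> w w' /historyP H; exact: eq_class_counts. Qed.

(** Some permutation of the individuals carries one history to the other, and it
    changes neither S nor the law of the sample. *)
Lemma integral_history_exchangeable n (psi : massPartition R -> R) w0 w1 :
  measurable_fun setT psi -> counts_at n w0 = counts_at n w1 ->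
  (\int[PP]_(w in history n @^-1` [set history n w0]) (psi (S w))%:E =
   \int[PP]_(w in history n @^-1` [set history n w1]) (psi (S w))%:E)%E.
Proof.
move=> mpsi c01.
have lab w : forall l m, same_at w l m =
    (first_mate (same_at w) l == first_mate (same_at w) m).
  move=> l m; apply: first_mate_eq;
    [exact: same_species_refl|exact: same_species_sym|exact: same_species_trans].
have [sigma [tau [pb e10]]] := perm_below_of_class_counts (lab w0) (lab w1) c01.
pose H e := (fun u : smp => (psi u.1)%:E) \_ (agree e n).
have mH e : measurable_fun setT (H e).
  apply/(measurable_restrictT _ (measurable_agree e n)); apply: measurable_funTS.
  by apply/measurable_EFinP; apply: (measurableT_comp mpsi); exact: measurable_sample_fst.
have HE w' : (\int[PP]_(w in history n @^-1` [set history n w']) (psi (S w))%:E =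
    \int[PP]_w H (same_at w') (sampling S X id w))%E.
  rewrite integral_mkcond history_fibre; apply: eq_integral => w _.
  by rewrite /H !patchE.
rewrite !HE -(integral_exchangeable X_id indep pb (mH (same_at w1))).
apply: eq_integral => w _; rewrite /H !patchE.
have -> // : (sampling S X id w \in agree (same_at w0) n) =
  (sampling S X sigma w \in agree (same_at w1) n).
apply/idP/idP; rewrite !inE => Aw l m ln mn.
  rewrite e10//.
  have := @same_species_perm n sigma tau (S w) (fun l => X l w) l m pb.
  rewrite /comp => ->; apply: Aw; by rewrite (perm_below_ltn _ pb).
have tn k : (k < n)%N -> (tau k < n)%N by move=> kn; rewrite (perm_below_ltn _ (perm_belowV pb)).
have := Aw (tau l) (tau m) (tn l ln) (tn m mn).
rewrite e10 ?tn// !(perm_belowVK pb) => <-.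
have := @same_species_perm n sigma tau (S w) (fun l => X l w) (tau l) (tau m) pb.
by rewrite /comp !(perm_belowVK pb) => ->.
Qed.

Local Open Scope ereal_scope.

Lemma integral_bigcup_history n (f : Omega -> R) (D : set (seq nat)) :
  PP.-integrable setT (EFin \o f) ->
  \int[PP]_(w in history n @^-1` D) (f w)%:E =
  \sum_(0 <= j <oo) \int[PP]_(w in history n @^-1` (D `&` [set c | pickle c = j])) (f w)%:E.
Proof.
move=> iF.
have E : history n @^-1` D = \bigcup_j (history n @^-1` (D `&` [set c | pickle c = j])).
  apply/seteqP; split => w /=; last by case=> j _ [].
  by move=> Dw; exists (pickle (history n w)).
rewrite E integral_bigcup//.
- by move=> i j _ _ [w [[_ /= <-] [_ /= <-]]].
- move=> j; apply: (measurable_sigma_of (measurable_history n)).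
  by eexists.
- apply: integrableS iF => //; rewrite -E.
  by apply: (measurable_sigma_of (measurable_history n)); eexists.
Qed.

(** The histories that lead to the same counts contribute equal amounts, with
    total 0, so that the common value cannot be positive. *)
Lemma integral_atom_le0 n (psi : massPartition R -> R) w0 :
  measurable_fun setT psi -> PP.-integrable setT (EFin \o (psi \o S)) ->
  \int[PP]_(w in counts_at n @^-1` [set counts_at n w0]) (psi (S w))%:E = 0 ->
  \int[PP]_(w in history n @^-1` [set history n w0]) (psi (S w))%:E <= 0.
Proof.
move=> mpsi ipsi zero; set I := (X in X <= 0).
rewrite leNgt; apply/negP => I0.
(* the histories compatible with the counts observed at w0 *)
pose D : set (seq nat) := [set c | exists2 w, history n w = c & counts_at n w = counts_at n w0].
have DE : counts_at n @^-1` [set counts_at n w0] = history n @^-1` D.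
  apply/seteqP; split => w /=; first by move=> wE; exists w.
  by move=> [w' /counts_determined -> ].
move: zero; rewrite DE (integral_bigcup_history n D ipsi).
pose t j := \int[PP]_(w in history n @^-1` (D `&` [set c | pickle c = j])) (psi (S w))%:E.
rewrite -/(t _) => zero.
have tE j : t j = 0 \/ t j = I.
  have [[c [[w wc cw] cj]]|nD] := pselect (exists c, D c /\ pickle c = j).
    right; rewrite /t /I (integral_history_exchangeable mpsi (esym cw)) wc.
    congr (integral _ _ _); congr (_ @^-1` _); apply/seteqP; split => c' /=.
      by move=> [_ c'j]; apply: (pcan_inj pickleK); rewrite c'j cj.
    by move=> ->; split => //; exists w.
  left; rewrite /t (_ : _ `&` _ = set0) ?preimage_set0 ?integral_set0//.
  by apply/seteqP; split => c //= [Dc cj]; apply: nD; exists c.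
have t0 j : 0 <= t j by case: (tE j) => ->//; exact: ltW.
have tI : t (pickle (history n w0)) = I.
  rewrite /t /I; congr (integral _ _ _); congr (_ @^-1` _); apply/seteqP; split => c /=.
    by move=> [_ cj]; exact: (pcan_inj pickleK).
  by move=> ->; split => //; exists w0.
have : I <= \sum_(0 <= j <oo) t j.
  rewrite (@nneseriesD1 _ t (pickle (history n w0)))// tI leeDl//.
  exact: nneseries_ge0.
by rewrite /t zero leNgt I0.
Qed.

(** Sufficiency of the counts.  Where the counts are fixed, y is a constant t, and
    [integral_atom_le0] applied to gam - t and to t - gam shows that y and gam have
    the same integral over each history. *)
Lemma cond_expectation_history n (gam : massPartition R -> R) (y : Omega -> R) :
  measurable_fun setT gam -> PP.-integrable setT (EFin \o (gam \o S)) ->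
  PP.-integrable setT (EFin \o y) -> determined_by (counts_at n) y ->
  (forall A, sigma_of (counts_at n) A ->
     \int[PP]_(w in A) (y w)%:E = \int[PP]_(w in A) (gam (S w))%:E) ->
  forall A, sigma_of (history n) A ->
     \int[PP]_(w in A) (y w)%:E = \int[PP]_(w in A) (gam (S w))%:E.
Proof.
move=> mgam igam iy cy cond.
have icst (t : R) : PP.-integrable setT (EFin \o (fun=> t)) by exact: finite_measure_integrable_cst.
have sub_counts : forall A, sigma_of (counts_at n) A -> measurable A.
  move=> A sA; apply: (measurable_sigma_of (measurable_history n)).
  exact: (sigma_of_sub (@counts_determined n) sA).
have atom w0 : \int[PP]_(w in history n @^-1` [set history n w0]) (y w)%:E =
    \int[PP]_(w in history n @^-1` [set history n w0]) (gam (S w))%:E.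
  set A := history n @^-1` _.
  have mA : measurable A by exact: measurable_history.
  pose C := counts_at n @^-1` [set counts_at n w0].
  have sC : sigma_of (counts_at n) C by exists [set counts_at n w0].
  have mC := sub_counts _ sC.
  have iS (B : set Omega) (f : Omega -> R) : measurable B -> PP.-integrable setT (EFin \o f) ->
    PP.-integrable B (EFin \o f) by move=> mB; apply: integrableS.
  have yC w : C w -> y w = y w0 by move=> Cw; exact: cy.
  have AC : A `<=` C by move=> w /= Aw; exact: counts_determined Aw.
  pose psi s := (gam s - y w0)%R.
  have mpsi : measurable_fun setT psi by exact: measurable_funB.
  have ipsi : PP.-integrable setT (EFin \o (psi \o S)).
    by have := integrableB measurableT igam (icst (y w0)); apply: eq_integrable => // w _;
      rewrite /= EFinB.
  have diff (B : set Omega) : measurable B -> B `<=` C ->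
      \int[PP]_(w in B) (psi (S w))%:E =
      \int[PP]_(w in B) (gam (S w))%:E - \int[PP]_(w in B) (y w)%:E.
    move=> mB BC; rewrite -integralB_EFin//; [|exact: iS|exact: iS].
    apply: eq_integral => w /set_mem Bw; rewrite /psi EFinB yC//; exact: BC.
  have fin (B : set Omega) (f : Omega -> R) : measurable B ->
      PP.-integrable setT (EFin \o f) -> \int[PP]_(w in B) (f w)%:E \is a fin_num.
    by move=> mB iF; apply: integrable_fin_num => //; exact: (iS B f).
  have z1 : \int[PP]_(w in C) (psi (S w))%:E = 0.
    by rewrite diff// cond// subee// fin.
  have le1 := integral_atom_le0 mpsi ipsi z1.
  have mNpsi : measurable_fun setT (fun s => - psi s)%R by exact: measurableT_comp.
  have iNpsi : PP.-integrable setT (EFin \o ((fun s => - psi s)%R \o S)).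
    by have := integrableN ipsi; apply: eq_integrable => // w _; rewrite /= EFinN.
  have NE (B : set Omega) : measurable B -> \int[PP]_(w in B) (- psi (S w))%:E =
      - \int[PP]_(w in B) (psi (S w))%:E.
    move=> mB; under eq_integral do rewrite EFinN.
    rewrite integralN//; apply: integrable_add_def => //; exact: (iS B (psi \o S)).
  have z2 : \int[PP]_(w in C) (- psi (S w))%:E = 0 by rewrite NE// z1 oppe0.
  have le2 := integral_atom_le0 mNpsi iNpsi z2.
  have : \int[PP]_(w in A) (psi (S w))%:E = 0.
    apply/eqP; rewrite eq_le le1/=; move: le2; rewrite NE//.
    by rewrite oppe_le0.
  rewrite diff// => /eqP; rewrite sube_eq ?add0e; [|exact: fin|].
    by move=> /eqP ->.
  by apply: fin_num_adde_defr.
move=> _ [D _ <-].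
rewrite (integral_bigcup_history n D iy) (integral_bigcup_history n D igam).
apply: eq_eseriesr => j _.
have [[w0 [Dw cj]]|nD] := pselect (exists w, D (history n w) /\ pickle (history n w) = j).
  have -> : history n @^-1` (D `&` [set c | pickle c = j]) = history n @^-1` [set history n w0].
    apply/seteqP; split => w /=.
      by move=> [_ wj]; apply: (pcan_inj pickleK); rewrite wj cj.
    by move=> ->.
  exact: atom.
rewrite (_ : _ @^-1` _ = set0) ?integral_set0//.
by apply/seteqP; split => w //= [Dw wj]; apply: nD; exists w.
Qed.
End sufficiency.

(** * Posterior means *)

Section plugin_bounds.
Context (R : realType).

Lemma sum_class_counts_size (e : rel nat) n :
  reflexive e -> symmetric e -> transitive e ->
  \sum_(j <- class_counts e n) (j%:R : R) = n%:R.
Proof.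
move=> er es et; have lab := first_mate_eq er es et.
have labn l : (l < n)%N -> (first_mate e l < n)%N.
  by apply: leq_ltn_trans; apply: first_mate_min.
rewrite (sum_class_counts (lab := first_mate e) (K := n) _ (psi := fun j => j%:R))//.
have cE (i : nat) : (count_mem i (label_word (first_mate e) n))%:R =
    \sum_(l < n) (first_mate e l == i)%:R :> R.
  rewrite count_map -sum1_count natr_sum -(big_mkord xpredT (fun l => (first_mate e l == i)%:R)).
  by rewrite /index_iota subn0 big_mkcond/=; apply: eq_bigr => l _; case: ifP.
under eq_bigr do rewrite cE.
rewrite exchange_big/= (eq_bigr (fun=> 1)) ?sumr_const ?card_ord// => l _.
rewrite (bigD1 (Ordinal (labn l (ltn_ord l))))//= eqxx big1 ?addr0// => i.
by rewrite -val_eqE/= eq_sym => /negbTE ->.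
Qed.

Lemma class_counts_frequency (e : rel nat) n j : j \in class_counts e n ->
  0 <= (j%:R / n%:R : R) <= 1.
Proof.
move=> /mapP[l _ ->]; have := count_size (e l) (iota 0 n); rewrite size_iota => h.
rewrite divr_ge0//=; case: n h => [|n] h; first by rewrite invr0 mulr0.
by rewrite ler_pdivrMr ?ltr0n// mul1r ler_nat.
Qed.

Lemma plugin_gini_itv kappa (e : rel nat) n : 0 < kappa ->
  reflexive e -> symmetric e -> transitive e ->
  (0 <= gini kappa (frequencies R n (class_counts e n)) <= 1)%E.
Proof.
move=> k0 er es et; rewrite gini_frequencies// !lee_fin subr_ge0 lerBlDr lerDl.
rewrite sumr_ge0 ?andbT => [|j _]; last exact: powR_ge0.
apply: (@le_trans _ _ (\sum_(j <- class_counts e n) (j%:R / n%:R))).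
  rewrite big_seq [leRHS]big_seq; apply: ler_sum => j jn.
  apply: powR_le_id; last by rewrite lerDr ltW.
  exact: class_counts_frequency jn.
rewrite -mulr_suml sum_class_counts_size//.
by have [->|n0] := eqVneq (n%:R : R) 0; rewrite ?mul0r// divff.
Qed.

Lemma plugin_shannon_ge0 (e : rel nat) n :
  (0 <= shannon (frequencies R n (class_counts e n)))%E.
Proof.
rewrite shannon_frequencies lee_fin big_seq sumr_ge0// => j jn.
have /andP[j0 j1] := class_counts_frequency jn.
by rewrite mulr_ge0// oppr_ge0 ln_le0.
Qed.

Lemma gini_itv kappa (s : massPartition R) : 0 < kappa -> (0 <= gini kappa s <= 1)%E.
Proof.
move=> k0; have p0 i : (0 <= ((s i) `^ (kappa + 1))%:E)%E by rewrite lee_fin powR_ge0.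
have le1 : (\sum_(0 <= i <oo) ((s i) `^ (kappa + 1))%:E <= 1)%E.
  rewrite -(mass_sum1 s); apply: lee_nneseries => // i _.
  by rewrite lee_fin powR_le_id ?mass_itv// lerDr ltW.
have ge0 : (0 <= \sum_(0 <= i <oo) ((s i) `^ (kappa + 1))%:E)%E by exact: nneseries_ge0.
have fx : (\sum_(0 <= i <oo) ((s i) `^ (kappa + 1))%:E)%E \is a fin_num.
  by rewrite ge0_fin_numE// (le_lt_trans le1)// ltry.
rewrite /gini; apply/andP; split; first by rewrite sube_ge0// fx.
by rewrite -[leRHS]adde0; apply: leeD => //; rewrite oppe_le0.
Qed.

End plugin_bounds.

Section fine_integrable.
Context d (T : measurableType d) (R : realType) (mu : probability T R).
Local Open Scope ereal_scope.

Lemma integrable_fine_comp (f : T -> \bar R) : mu.-integrable setT f ->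
  mu.-integrable setT (EFin \o (fine \o f)).
Proof.
move=> /[dup] /integrableP[mf _]; apply: le_integrable => //.
  by apply/measurable_EFinP; apply: measurableT_comp.
by move=> w _ /=; case: (f w) => [r| |] //=; rewrite normr0 leey.
Qed.

Lemma ae_fine (f : T -> \bar R) : mu.-integrable setT f ->
  {ae mu, forall w, (fine (f w))%:E = f w}.
Proof.
by move=> /(integrable_ae measurableT); apply: filterS => w H; rewrite fineK// H.
Qed.

Lemma integral_fine_comp (f : T -> \bar R) A : measurable A -> mu.-integrable setT f ->
  \int[mu]_(w in A) (fine (f w))%:E = \int[mu]_(w in A) f w.
Proof.
move=> mA iF; have [mf _] := integrableP _ _ _ iF; apply: ae_eq_integral => //.
- by apply: measurable_funTS; have /integrableP[] := integrable_fine_comp iF.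
- exact: measurable_funTS.
- by apply: filterS (ae_fine iF).
Qed.
End fine_integrable.

Section posterior_mean.
Context (R : realType).
Variables (a : massPartition R -> nat -> R) (ha : interval_arrangement a).
Context d (Omega : measurableType d) (PP : probability Omega R).
Variables (S : {RV PP >-> massPartition R}) (X : nat -> {RV PP >-> R}).
Hypothesis X_id : forall l (B : set R), measurable B ->
  PP (X l @^-1` B) = PP (X 0%N @^-1` B).
Hypothesis indep : mutually_independent S X.

Variable gam : massPartition R -> \bar R.
Hypothesis mgam : measurable_fun setT gam.
Hypothesis gam0 : forall s, (0 <= gam s)%E.
Hypothesis igam : PP.-integrable setT (gam \o S).

Variable plugin : nat -> Omega -> R.
Hypothesis plugin_ge0 : forall n w, 0 <= plugin n w.
Hypothesis plugin_counts : forall n, determined_by (counts_at a S X n) (plugin n).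
Hypothesis plugin_cvg : cvg_as PP (fun n w => (plugin n w)%:E) (fun w => gam (S w)).

Variable Y : nat -> Omega -> \bar R.
Hypothesis Y_cond : forall n,
  is_cond_expectation PP (counts_at a S X n) (fun w => gam (S w)) (Y n).

Let g w : R := fine (gam (S w)).
Let y n w : R := fine (Y n w).

Let m_counts n A : sigma_of (counts_at a S X n) A -> measurable A.
Proof.
move=> sA; apply: (measurable_sigma_of (measurable_history ha S X n)).
exact: (sigma_of_sub (@counts_determined _ a ha _ _ _ S X n) sA).
Qed.

Lemma measurable_posterior n : measurable_fun setT (Y n).
Proof. by case: (Y_cond n) => sY _ _ _ B mB; rewrite setTI; exact/m_counts/sY. Qed.

Let iY n : PP.-integrable setT (Y n). Proof. by case: (Y_cond n). Qed.

Let counts_y n : determined_by (counts_at a S X n) (y n).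
Proof.
move=> w w' ww'; congr fine; case: (Y_cond n) => sY _ _.
have [C _ CE] := sY _ (emeasurable_set1 (Y n w)).
have : (Y n @^-1` [set Y n w]) w by [].
rewrite -CE /= ww' => Cw'.
have : (counts_at a S X n @^-1` C) w' by [].
by rewrite CE.
Qed.

Let cond_counts n A : sigma_of (counts_at a S X n) A ->
  (\int[PP]_(w in A) (y n w)%:E = \int[PP]_(w in A) (g w)%:E)%E.
Proof.
move=> sA; have mA := m_counts sA.
rewrite (integral_fine_comp mA (iY n)) (integral_fine_comp mA igam).
by case: (Y_cond n) => _ _ ->.
Qed.

Let ig : PP.-integrable setT (EFin \o g). Proof. exact: integrable_fine_comp igam. Qed.
Let iy n : PP.-integrable setT (EFin \o y n). Proof. exact: integrable_fine_comp (iY n). Qed.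

Let history_y n : determined_by (history a S X n) (y n).
Proof. by move=> w w' /(counts_determined ha); exact: counts_y. Qed.

Let cond_history n A : sigma_of (history a S X n) A ->
  (\int[PP]_(w in A) (y n w)%:E = \int[PP]_(w in A) (g w)%:E)%E.
Proof.
apply: (@cond_expectation_history _ _ ha _ _ _ _ _ X_id indep n (fine \o gam)) => //.
  exact: measurableT_comp.
exact: cond_counts.
Qed.

Let ae_gam : {ae PP, forall w, (g w)%:E = gam (S w)}.
Proof. exact: ae_fine igam. Qed.

Let approximable (e : R) : 0 < e -> exists m (h : Omega -> R),
  [/\ PP.-integrable setT (EFin \o h), determined_by (history a S X m) h &
      (\int[PP]_w `|(g w - h w)%:E| <= e%:E)%E].
Proof.
apply: (approximable_of_ae_cvg (K := history a S X) (h := plugin)) => //.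
- exact: measurable_history.
- by move=> w; rewrite fine_ge0.
- by move=> n w w' /(counts_determined ha); exact: plugin_counts.
- apply: filterS2 plugin_cvg ae_gam => w; move=> + gw; rewrite -gw => H.
  exact: fine_cvg H.
Qed.

(** By sufficiency the posterior means are conditional expectations along an
    increasing family, and G(S) is approximated by the plug-in estimators. *)
Lemma posterior_cvg_as : cvg_as PP Y (fun w => gam (S w)).
Proof.
have H1 := levy_ae (@measurable_history _ _ ha _ _ _ S X) (@history_refine _ _ ha _ _ _ S X)
  ig iy history_y cond_history approximable.
have H2 := ae_foralln (fun n => ae_fine (iY n)).
apply: filterS3 H1 H2 ae_gam => w yg yY gw; rewrite -gw.
apply: (@cvg_trans _ ((y n w)%:E @[n --> \oo])).
  by apply: near_eq_cvg; apply: nearW => n; rewrite yY.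
by apply: cvg_EFin; first exact: nearW.
Qed.

Lemma posterior_cvg_L1 : cvg_Lp PP 1 Y (fun w => gam (S w)).
Proof.
have in1 (f : Omega -> \bar R) : PP.-integrable setT f -> in_Lp PP 1 f.
  by move=> /integrableP[mf fi]; split => //; rewrite Lnorm1.
split; [by move=> n; exact: in1|exact: in1 igam|].
have := levy_L1 (@measurable_history _ _ ha _ _ _ S X) (@history_refine _ _ ha _ _ _ S X)
  ig iy history_y cond_history approximable.
apply: cvg_trans; apply: near_eq_cvg; apply: nearW => n; rewrite Lnorm1.
have mY := measurable_posterior n.
have mg : measurable_fun setT (fun w => gam (S w)) by case/integrableP: igam.
apply: ae_eq_integral => //.
- apply: measurableT_comp => //; apply/measurable_EFinP; apply: measurable_funB.
    exact: measurableT_comp.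
  exact: measurableT_comp.
- by apply: measurableT_comp => //; exact: emeasurable_funB.
- apply: filterS2 (ae_fine (iY n)) ae_gam => w yY gw _.
  by rewrite EFinB yY gw.
Qed.

Lemma posterior_itv n : (forall s, gam s <= 1)%E -> {ae PP, forall w, (0 <= Y n w <= 1)%E}.
Proof.
move=> gam1.
have := cond_expectation_itv01 _ (counts_y (n := n)) (iy n) ig (@cond_counts n) _.
have h1 c : measurable (counts_at a S X n @^-1` [set c]) by apply: (@m_counts n); exists [set c].
have h2 w : 0 <= g w <= 1.
  rewrite fine_ge0//= -lee_fin fineK// ge0_fin_numE//.
  by apply: le_lt_trans (gam1 _) _; rewrite ltry.
move=> /(_ h1 h2); apply: filterS2 (ae_fine (iY n)) => w <-.
by rewrite !lee_fin.
Qed.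
End posterior_mean.

Theorem proposition3 (R : realType)
  (P : probability (massPartition R) R)
  (entropy_fin : (\int[P]_s shannon s < +oo)%E)
  (kappa : R) (kappa_gt0 : 0 < kappa)
  (a : massPartition R -> nat -> R) (ha : interval_arrangement a)
  (d : measure_display) (Omega : measurableType d) (PP : probability Omega R)
  (S : {RV PP >-> massPartition R}) (X : nat -> {RV PP >-> R})
  (S_law : forall A : set (massPartition R), measurable A ->
     distribution PP S A = P A)
  (X_law : forall (l : nat) (B : set R), measurable B ->
     distribution PP (X l) B = uniform_prob (@ltr01 R) B)
  (indep : mutually_independent S X) :
  let pi (n : nat) (w : Omega) : seq nat :=
    species_counts a (S w) (fun l => X l w) n in
  let giniS (w : Omega) : \bar R := gini kappa (S w) in
  let shannonS (w : Omega) : \bar R := shannon (S w) in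
  let plugin_gini (n : nat) (w : Omega) : \bar R :=
    gini kappa (frequencies R n (pi n w)) in
  let plugin_shannon (n : nat) (w : Omega) : \bar R :=
    shannon (frequencies R n (pi n w)) in
  [/\ forall Y : nat -> Omega -> \bar R,
        (forall n, is_cond_expectation PP (pi n) giniS (Y n)) ->
        cvg_as PP Y giniS /\ (forall p : R, 1 <= p -> cvg_Lp PP p Y giniS),
      cvg_as PP plugin_gini giniS /\
        (forall p : R, 1 <= p -> cvg_Lp PP p plugin_gini giniS),
      forall Y : nat -> Omega -> \bar R,
        (forall n, is_cond_expectation PP (pi n) shannonS (Y n)) ->
        cvg_as PP Y shannonS /\ cvg_Lp PP 1 Y shannonS
    & cvg_as PP plugin_shannon shannonS].
Proof.
move=> pi giniS shannonS plugin_gini plugin_shannon.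
have X_unif l (B : set R) : measurable B -> PP (X l @^-1` B) = uniform_prob (@ltr01 R) B.
  exact: X_law.
have X_id l (B : set R) : measurable B -> PP (X l @^-1` B) = PP (X 0%N @^-1` B).
  by move=> mB; rewrite !X_unif.
have mshannon : measurable_fun setT shannonS.
  exact: (measurableT_comp (@measurable_shannon R)).
have mgini : measurable_fun setT giniS.
  exact: (measurableT_comp (@measurable_gini R kappa)).
have shannonS_fin : (\int[PP]_w shannon (S w) < +oo)%E.
  apply: le_lt_trans entropy_fin; rewrite le_eqVlt; apply/orP; left; apply/eqP.
  transitivity (\int[distribution PP S]_s shannon s)%E.
    rewrite ge0_integral_distribution//; first exact: measurable_shannon.
    by move=> s; exact: shannon_ge0 (mass_itv s).
  by apply: (eq_measure_integral P) => A mA _; exact: S_law.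
have ishannon : PP.-integrable setT ((fun s : massPartition R => shannon s) \o S).
  apply/integrableP; split => //.
  by under eq_integral => w _ do rewrite /= gee0_abs ?(shannon_ge0 (mass_itv _))//.
have igini : PP.-integrable setT ((fun s : massPartition R => gini kappa s) \o S).
  apply/integrableP; split => //; apply: (@le_lt_trans _ _ (\int[PP]_w 1)%E).
    apply: ge0_le_integral => //; first exact: measurableT_comp.
    by move=> w _; have /andP[g0 g1] := gini_itv (S w) kappa_gt0; rewrite gee0_abs.
  by rewrite integral_cst_probability ltry.
have ae_species := ae_in_some_species ha X_unif indep.
have ae_freq := ae_species_frequency ha X_unif indep.
have plugin_gini_cvg : cvg_as PP plugin_gini giniS.
  apply: filterS2 ae_species ae_freq => w sp fr.
  exact: (@cvg_plugin_gini _ _ ha (S w) (fun l => X l w) sp fr).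
have plugin_shannon_cvg : cvg_as PP plugin_shannon shannonS.
  have ae_tail := ae_mean_surprise ha X_unif indep shannonS_fin.
  have ae_fin : {ae PP, forall w, (shannon (S w) < +oo)%E}.
    apply: filterS (integrable_ae measurableT ishannon) => w /(_ I).
    by rewrite ge0_fin_numE//; exact: shannon_ge0 (mass_itv _).
  have cvg_fin : {ae PP, forall w, (shannon (S w) < +oo)%E ->
      plugin_shannon n w @[n --> \oo] --> shannonS w}.
    apply: filterS3 ae_species ae_freq ae_tail => w sp fr tl.
    exact: (@cvg_plugin_shannon _ _ ha (S w) (fun l => X l w) sp fr tl).
  by apply: filterS2 cvg_fin ae_fin => w; exact.
have pg01 n w : (0 <= plugin_gini n w <= 1)%E.
  apply: plugin_gini_itv => //.
  - exact: same_species_refl.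
  - exact: same_species_sym.
  - exact: same_species_trans.
have mplugin n (f : seq nat -> \bar R) : measurable_fun setT (f \o pi n).
  apply: (measurable_determined (measurable_history ha S X n)).
  by move=> w w' /(counts_determined ha) /= E; congr f.
have gS01 w : (0 <= giniS w <= 1)%E by exact: gini_itv.
split.
- move=> Y Ycond.
  pose h n w := fine (plugin_gini n w).
  have hE n w : (h n w)%:E = plugin_gini n w.
    by have /andP[p0 p1] := pg01 n w; rewrite fineK// ge0_fin_numE// (le_lt_trans p1)// ltry.
  have h0 n w : 0 <= h n w by rewrite fine_ge0//; case/andP: (pg01 n w).
  have hc n : determined_by (counts_at a S X n) (h n).
    by move=> w w' E; rewrite /h /plugin_gini /pi -/(counts_at a S X n w) E.
  have hcv : cvg_as PP (fun n w => (h n w)%:E) giniS.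
    by apply: filterS plugin_gini_cvg => w; under [in X in _ -> X]eq_fun do rewrite hE.
  have g0 s : (0 <= gini kappa (s : massPartition R))%E by case/andP: (gini_itv s kappa_gt0).
  have g1 s : (gini kappa (s : massPartition R) <= 1)%E by case/andP: (gini_itv s kappa_gt0).
  have mg := @measurable_gini R kappa.
  split; first exact: (posterior_cvg_as ha X_id indep mg g0 igini h0 hc hcv Ycond).
  move=> p p1; apply: bounded_cvg_Lp => //.
  + exact: (measurable_posterior ha (gam := fun s : massPartition R => gini kappa s) Ycond).
  + by move=> n; exact: (posterior_itv ha (gam := fun s : massPartition R => gini kappa s)
      g0 igini Ycond n g1).
  + exact: aeW.
  + have [_ _] := posterior_cvg_L1 ha X_id indep mg g0 igini h0 hc hcv Ycond.
    by under eq_fun do rewrite Lnorm1.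
- split => // p p1; apply: bounded_cvg_Lp => //.
  + by move=> n; exact: (mplugin n (fun c => gini kappa (frequencies R n c))).
  + by move=> n; exact: aeW.
  + exact: aeW.
  + have [] // := @dominated_convergence _ _ _ PP setT measurableT plugin_gini giniS (cst 1%E).
    * by move=> n; exact: (mplugin n (fun c => gini kappa (frequencies R n c))).
    * by apply: filterS plugin_gini_cvg => w + _.
    * exact: finite_measure_integrable_cst.
    * by apply: aeW => w n _; have /andP[p0 p1'] := pg01 n w; rewrite gee0_abs.
- move=> Y Ycond.
  pose h n w := fine (plugin_shannon n w).
  have hE n w : (h n w)%:E = plugin_shannon n w by rewrite /h /plugin_shannon shannon_frequencies.
  have h0 n w : 0 <= h n w by rewrite fine_ge0//; exact: plugin_shannon_ge0.
  have hc n : determined_by (counts_at a S X n) (h n).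
    by move=> w w' E; rewrite /h /plugin_shannon /pi -/(counts_at a S X n w) E.
  have hcv : cvg_as PP (fun n w => (h n w)%:E) shannonS.
    by apply: filterS plugin_shannon_cvg => w; under [in X in _ -> X]eq_fun do rewrite hE.
  have g0 s : (0 <= shannon (s : massPartition R))%E by exact: shannon_ge0 (mass_itv s).
  have mg := @measurable_shannon R.
  split; first exact: (posterior_cvg_as ha X_id indep mg g0 ishannon h0 hc hcv Ycond).
  exact: (posterior_cvg_L1 ha X_id indep mg g0 ishannon h0 hc hcv Ycond).
- exact: plugin_shannon_cvg.
Qed.
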